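(* Let $d \ge 2$ be an integer. Let $X_1, \dots, X_{2d} \subset \mathbb{R}^d$ be sets and let $c_1, \dots, c_{2d} \in \mathbb{R}^d$ be points such that $$c_i + \mathbf{B}^d \subset \operatorname{conv} X_i \qquad \text{for every } i \in \{1,\dots,2d\}.$$ Then there are points $x_i \in X_i$, $i \in \{1,\dots,2d\}$, and a point $c \in \operatorname{conv}\{c_1, \dots, c_{2d}\}$ such that $$c + (3d)^{-2d^2}\, \mathbf{B}^d \subset \operatorname{conv}\{x_1, \dots, x_{2d}\}.$$
   Context: $\mathbf{B}^d$ denotes the (closed) Euclidean unit ball of $\mathbb{R}^d$ centered at the origin, and $\operatorname{conv} X$ is the convex hull of $X$. The sets $X_i$ are arbitrary (they may be infinite and may overlap); exactly one point is chosen from each $X_i$, and chosen points with different indices may coincide. *)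

(* Defs.v *)
From mathcomp Require Import all_boot all_order all_algebra.
From mathcomp Require Import all_classical all_reals all_analysis.

Set Implicit Arguments.
Unset Strict Implicit.
Unset Printing Implicit Defensive.

Import Order.TTheory GRing.Theory Num.Theory.

Local Open Scope classical_set_scope.
Local Open Scope ring_scope.

(* The library's norm on 'rV[R]_d is the sup norm, hence this definition. *)
Definition enorm (R : realType) (d : nat) (x : 'rV[R]_d) : R :=
  Num.sqrt (\sum_(i < d) x 0 i ^+ 2).

Definition unit_ball (R : realType) (d : nat) : set 'rV[R]_d :=
  [set x | enorm x <= 1].
Arguments unit_ball : clear implicits.

Definition conv_hull (R : realType) (d : nat) (X : set 'rV[R]_d) :
  set 'rV[R]_d := smallest (@convex_set R 'rV[R]_d) X.

(* Main.v *)
Require Import Defs.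
From mathcomp Require Import all_boot all_order all_algebra.
From mathcomp Require Import all_classical all_reals all_analysis.
From mathcomp Require Import zify ring lra.

Set Implicit Arguments.
Unset Strict Implicit.
Unset Printing Implicit Defensive.

Import Order.TTheory GRing.Theory Num.Theory.
Import numFieldNormedType.Exports.

Local Open Scope classical_set_scope.
Local Open Scope ring_scope.

(* Only the points c_i +- e_k are needed, so the X_i may be taken finite and all
   extrema are attained.  A configuration is a rainbow choice x with weights w, v
   such that sum w_i x_i = sum v_l c_l; both sides are lifted to R^(d+1) by
   x |-> (x, 1).  Among all configurations and all matrices with d rows
   w_i (x_i, 1) or rho (e_k, 0) and one row v_l (c_l, 1), maximise |det|.
   Maximality bounds the coordinates of every w_i (x_i, 1) and rho (e_k, 0) in
   the rows of the optimal matrix.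
   Freezing the colours used by some rows, the others can be moved: a quadratic
   penalty on the residual error, Caratheodory sparsification (which leaves an
   unused colour, as there are 2d of them) and averaging over c_j +- e_k show
   that sum w_i |theta x_i| can be raised to a fixed level for any affine
   functional theta with a coefficient at least 1.  This increases the
   determinant if a row rho (e_k, 0) was present; and if all d rows are colours,
   it produces one more colour far from their hyperplane, so that the (e_k, 0)
   are combinations of the w_i (x_i, 1) with bounded coefficients, and the
   weights can be perturbed to reach a ball around the common point. *)

(** The delicate point is the count of spare colours. Sparsification leaves at most [d + 1] active
    moving weights, colours and centres together; with [a] frozen colours among [2 d], a spare one
    is certain once [a + 1 < d + (active centres)]. If a row [rho e_k] is present, [a <= d - 1] and
    one active centre suffices. If all [d] rows are colours, two are needed, yet the moving mass
    might collapse onto one centre. Each centre is therefore mixed with a share [sg] of the centre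
    of the last row, [sg] being chosen so that no mixed centre lies near the hyperplane of the
    colour rows: a single mixed centre could then be balanced only by points of large gain. The
    constants are tuned backwards. [rho = 1 / (64 d^2)] makes the exchange of a row [rho e_k]
    multiply the determinant by more than 1 although half of the centre row is given up, and
    [eps = rho / (42 d^2)] is what the pigeonhole choice of [sg] can afford. The resulting radius is
    polynomial in [1 / d]; it is compared with the stated one through [(3 d)^8 <= (3 d)^(2 d^2)], an
    equality at [d = 2]. *)

Definition lincomb (R : realType) (T : finType) (V : lmodType R)
  (z : T -> V) (s : T -> R) : V := \sum_t s t *: z t.

Definition linform (R : realType) (T : finType) (g s : T -> R) : R :=
  \sum_t s t * g t.

(** * Linear combinations over a finite index type, null directions, small steps *)

Section LinearCombinations.
Variables (R : realType) (T : finType).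
Implicit Types (s : T -> R) (a : R).

Lemma lincombD (V : lmodType R) (z : T -> V) s s' a :
  lincomb z (fun t => s t + a * s' t) = lincomb z s + a *: lincomb z s'.
Proof.
rewrite /lincomb scaler_sumr -big_split; apply: eq_bigr => t _ /=.
by rewrite scalerDl scalerA.
Qed.

Lemma linformD (g s s' : T -> R) a :
  linform g (fun t => s t + a * s' t) = linform g s + a * linform g s'.
Proof.
by rewrite /linform mulr_sumr -big_split; apply: eq_bigr => t _ /=; ring.
Qed.

Lemma lincombZ (V : lmodType R) (z : T -> V) s a :
  lincomb z (fun t => a * s t) = a *: lincomb z s.
Proof.
by rewrite /lincomb scaler_sumr; apply: eq_bigr => t _; rewrite scalerA.
Qed.

Lemma lincomb_coord (k : nat) (z : T -> 'rV[R]_k) s j :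
  lincomb z s 0 j = linform (fun t => z t 0 j) s.
Proof. by rewrite /lincomb summxE; apply: eq_bigr => t _; rewrite mxE. Qed.

Lemma linform_ge0 (g s : T -> R) :
  (forall t, 0 <= g t) -> (forall t, 0 <= s t) -> 0 <= linform g s.
Proof. by move=> g0 s0; apply: sumr_ge0 => t _; exact: mulr_ge0. Qed.

(* A null combination supported on [P] exists as soon as [P] has more
   elements than the dimension. *)
Lemma null_direction (k : nat) (z : T -> 'rV[R]_k) (P : {set T}) :
  (k < #|P|)%N ->
  exists e : T -> R, [/\ exists t, e t != 0, forall t, t \notin P -> e t = 0 &
    lincomb z e = 0].
Proof.
move=> kP; pose M : 'M[R]_(#|P|, k) := \matrix_(i < #|P|) z (enum_val i).
have : kermx M != 0.
  rewrite kermx_eq0 -row_leq_rank -ltnNge.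
  exact: leq_ltn_trans (rank_leq_col M) kP.
case/rowV0Pn => v /sub_kermxP vM v0.
(* The kernel vector, indexed by the enumeration of [P], is extended by zero to [T]. *)
pose e t := \sum_(i < #|P|) v 0 i *+ (enum_val i == t).
have eV i : e (enum_val i) = v 0 i.
  rewrite /e (bigD1 i) //= eqxx mulr1n big1 ?addr0 // => j ji.
  by rewrite (inj_eq enum_val_inj) (negbTE ji).
exists e; split.
- have [i vi] : exists i, v 0 i != 0.
    apply/existsP; apply: contraNT v0; rewrite negb_exists => /forallP v0.
    by apply/eqP/rowP => i; rewrite mxE; apply/eqP; rewrite -[_ == _]negbK v0.
  by exists (enum_val i); rewrite eV.
- move=> t tP; rewrite /e big1 // => i _; case: eqP => // it.
  by move: tP; rewrite -it enum_valP.
- rewrite /lincomb (bigID (mem P)) /= [X in _ + X]big1 ?addr0; last first.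
    move=> t tP; rewrite /e big1 ?scale0r // => i _; case: eqP => // it.
    by move: tP; rewrite -it enum_valP.
  rewrite -[RHS]vM mulmx_sum_row big_enum_val; apply: eq_bigr => i _.
  by rewrite eV rowK.
Qed.

(** With [q] the sum of all ratios [|b t| / a t], the step [1 / (1 + q)] serves every index at
    once. *)
Lemma small_step (a b : T -> R) : (forall t, 0 < a t) ->
  exists2 h, 0 < h & forall h', 0 <= h' <= h -> forall t, 0 < a t + h' * b t.
Proof.
move=> a0; pose q := \sum_t `|b t| / a t.
have q0 : 0 <= q by apply: sumr_ge0 => t _; rewrite divr_ge0 // ltW.
exists (1 + q)^-1; first by rewrite invr_gt0; lra.
move=> h' /andP[h0 hq] t.
have bq : `|b t| <= q * a t.
  rewrite -ler_pdivrMr // /q (bigD1 t) //= lerDl.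
  by apply: sumr_ge0 => t' _; rewrite divr_ge0 // ltW.
have hq1 : h' * (1 + q) <= 1 by rewrite -ler_pdivlMr ?div1r //; lra.
have : - (h' * `|b t|) <= h' * b t by rewrite -mulrN ler_wpM2l // lerNl -normrN ler_norm.
have := a0 t; have : h' * `|b t| <= h' * (q * a t) by rewrite ler_wpM2l.
have [->|h'0] := eqVneq h' 0; first by rewrite !mul0r; lra.
have : 0 < h' * a t by rewrite mulr_gt0 // lt_neqAle eq_sym h'0.
have : h' * (1 + q) * a t <= 1 * a t by rewrite ler_pM2r.
lra.
Qed.

End LinearCombinations.

(** * Maxima of continuous functions on boxes, by Tychonoff *)

Section BoxOptimum.
Variables (R : realType) (T : finType).
Let V := prod_topology (fun _ : T => (R : topologicalType)).
Implicit Types (f : V -> R) (K : set V).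

Lemma coordinate_continuous (t : T) : continuous (fun s : V => s t : R).
Proof. exact: (@proj_continuous T (fun _ => (R : topologicalType)) t). Qed.

Lemma continuousM_fun f f' :
  continuous f -> continuous f' -> continuous (fun s => f s * f' s).
Proof.
move=> cf cf' s.
exact: (@cvgM R V (nbhs s) (nbhs_filter s) f f' (f s) (f' s) (cf s) (cf' s)).
Qed.

Lemma continuousD_fun f f' :
  continuous f -> continuous f' -> continuous (fun s => f s + f' s).
Proof.
move=> cf cf' s.
exact: (@cvgD R R V (nbhs s) (nbhs_filter s) f f' (f s) (f' s) (cf s) (cf' s)).
Qed.

Lemma continuousN_fun f : continuous f -> continuous (fun s => - f s).
Proof. by move=> cf s; exact: (@cvgN R R V (nbhs s) (nbhs_filter s) f (f s) (cf s)). Qed.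

Lemma continuous_sum_fun (I : finType) (F : I -> V -> R) :
  (forall i, continuous (F i)) -> continuous (fun s => \sum_i F i s).
Proof.
move=> cF; apply: (@continuous_big R I +%R 0) => // -[x y] /=.
by apply: cvgD; [exact: cvg_fst|exact: cvg_snd].
Qed.

Lemma continuous_prod_fun (I : finType) (F : I -> V -> R) :
  (forall i, continuous (F i)) -> continuous (fun s => \prod_i F i s).
Proof.
move=> cF; apply: (@continuous_big R I *%R 1) => //.
by move=> x; apply: cvgM; [exact: cvg_fst|exact: cvg_snd].
Qed.

Lemma linform_continuous (g : T -> R) : continuous (fun s : V => linform g s).
Proof.
apply: continuous_sum_fun => t; apply: continuousM_fun; last exact: cst_continuous.
exact: coordinate_continuous.
Qed.

Lemma closed_sublevel f a : continuous f -> closed [set s | f s <= a].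
Proof. by move=> /continuous_closedP/(_ _ (@closed_le R a)). Qed.

Lemma closed_superlevel f a : continuous f -> closed [set s | a <= f s].
Proof. by move=> /continuous_closedP/(_ _ (@closed_ge R a)). Qed.

Lemma closed_level f a : continuous f -> closed [set s | f s = a].
Proof.
move=> cf; have -> : [set s | f s = a] = [set s | f s <= a] `&` [set s | a <= f s].
  apply/seteqP; split=> s /= => [->//|[fa af]].
  by apply/eqP; rewrite eq_le fa af.
by apply: closedI; [exact: closed_sublevel|exact: closed_superlevel].
Qed.

Lemma box_max (B : R) f K : continuous f -> closed K ->
  (exists2 s, forall t, 0 <= s t <= B & K s) ->
  exists s, [/\ forall t, 0 <= s t <= B, K s &
    forall s', (forall t, 0 <= s' t <= B) -> K s' -> f s' <= f s].
Proof.
move=> cf Kcl [s0 s0B s0K].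
pose D : set V := [set s | forall t, s t \in `[0, B] ].
have bK : compact D.
  exact: (@tychonoff T (fun _ => R : topologicalType)
    (fun _ => [set x | x \in `[0, B] ]) (fun _ => @segment_compact R 0 B)).
have cK : compact (D `&` K) by exact: compact_closedI.
have DK0 : (D `&` K) !=set0.
  by exists s0; split => // t /=; rewrite in_itv /= s0B.
have [s /set_mem[sB sK] smax] :=
  compact_EVT_max DK0 cK (continuous_subspaceT cf).
exists s; split => // s' s'B s'K; apply: smax; apply/mem_set; split => //.
Qed.

End BoxOptimum.

Lemma finite_family_max (R : realType) (I : finType) (V : Type) (f : I -> V -> R)
    (K : I -> set V) :
  (forall i, (exists v, K i v) ->
     exists2 v, K i v & forall v', K i v' -> f i v' <= f i v) ->
  (exists i v, K i v) ->
  exists i v, K i v /\ forall j v', K j v' -> f j v' <= f i v.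
Proof.
move=> Kmax [i0 [v0 Kv0]].
(* [v0] is only a default value: the maximum below runs over indices [i] with [K i] inhabited. *)
pose g i : V := if pselect (exists v, K i v) is left h
  then projT1 (cid2 (Kmax i h)) else v0.
have gP i v : K i v -> K i (g i) /\ f i v <= f i (g i).
  move=> Kv; rewrite /g; case: pselect => [h|]; last by case; exists v.
  by case: cid2 => v' Kv' v'max /=; split => //; exact: v'max.
case: (@arg_maxP _ R I i0 (fun i => `[< exists v, K i v >]) (fun i => f i (g i))).
  by apply/asboolP; exists v0.
move=> i /asboolP[v /gP[Kgi _]] imax; exists i, (g i); split => // j v' Kv'.
by apply: le_trans (gP _ _ Kv').2 _; apply: imax; apply/asboolP; exists v'.
Qed.

(** * Lifting to dimension [d + 1], linear functionals, convex functions on hulls *)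

Definition hat (R : realType) (d : nat) (x : 'rV[R]_d) : 'rV[R]_(d + 1) :=
  row_mx x 1%:M.

Definition pairing (R : realType) (k : nat) (z : 'rV[R]_k) (th : 'cV[R]_k) : R :=
  (z *m th) 0 0.

Definition sqnorm (R : realType) (k : nat) (v : 'rV[R]_k) : R :=
  \sum_j v 0 j ^+ 2.

(** The lift of a direction instead of a point, hence the last coordinate 0. *)
Definition ehat (R : realType) (d : nat) (k : 'I_d) : 'rV[R]_(d + 1) :=
  row_mx (delta_mx 0 k) 0.

Section Pairing.
Variables (R : realType) (k : nat).

Lemma pairingD (z z' : 'rV[R]_k) th :
  pairing (z + z') th = pairing z th + pairing z' th.
Proof. by rewrite /pairing mulmxDl mxE. Qed.

Lemma pairingN (z : 'rV[R]_k) th : pairing (- z) th = - pairing z th.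
Proof. by rewrite /pairing mulNmx mxE. Qed.

Lemma pairing0 (th : 'cV[R]_k) : pairing 0 th = 0.
Proof. by rewrite /pairing mul0mx mxE. Qed.

Lemma pairingZ a (z : 'rV[R]_k) th : pairing (a *: z) th = a * pairing z th.
Proof. by rewrite /pairing -scalemxAl mxE. Qed.

Lemma pairingZr a (z : 'rV[R]_k) th : pairing z (a *: th) = a * pairing z th.
Proof. by rewrite /pairing -scalemxAr mxE. Qed.

Lemma pairing_sum (I : finType) (z : I -> 'rV[R]_k) th :
  pairing (\sum_i z i) th = \sum_i pairing (z i) th.
Proof. by rewrite /pairing mulmx_suml summxE. Qed.

Lemma pairing_lincomb (T : finType) (z : T -> 'rV[R]_k) (s : T -> R) th :
  pairing (lincomb z s) th = linform (fun t => pairing (z t) th) s.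
Proof. by rewrite pairing_sum; apply: eq_bigr => t _; rewrite pairingZ. Qed.

Lemma sqnorm_ge0 (v : 'rV[R]_k) : 0 <= sqnorm v.
Proof. by apply: sumr_ge0 => j _; exact: sqr_ge0. Qed.

Lemma sqnorm_eq0 (v : 'rV[R]_k) : sqnorm v = 0 -> v = 0.
Proof.
move=> v0; apply/rowP => j; rewrite mxE; apply/eqP; rewrite -sqrf_eq0.
by apply/eqP; apply: (psumr_eq0P _ v0) => // i _; exact: sqr_ge0.
Qed.

Lemma sqnormD (v w : 'rV[R]_k) a :
  sqnorm (v + a *: w) =
  sqnorm v + a * (2 * pairing w v^T) + a ^+ 2 * sqnorm w.
Proof.
rewrite /sqnorm /pairing mxE !mulr_sumr -!big_split; apply: eq_bigr => j _ /=.
by rewrite !mxE; ring.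
Qed.

Lemma coord_le_sqnorm (v : 'rV[R]_k) j : v 0 j <= 1 + sqnorm v.
Proof.
have : v 0 j ^+ 2 <= sqnorm v.
  by rewrite /sqnorm (bigD1 j) //= lerDl sumr_ge0 // => i _; exact: sqr_ge0.
nra.
Qed.

End Pairing.

Section Lifting.
Variables (R : realType) (d : nat).

Lemma hat_last (x : 'rV[R]_d) : hat x 0 (rshift d 0) = 1.
Proof. by rewrite /hat row_mxEr mxE. Qed.

Lemma ehat_last (i : 'I_d) : ehat R i 0 (rshift d 0) = 0.
Proof. by rewrite /ehat row_mxEr mxE. Qed.

Lemma hat_conv (x y : 'rV[R]_d) l :
  hat (l *: x + (1 - l) *: y) = l *: hat x + (1 - l) *: hat y.
Proof.
rewrite /hat !scale_row_mx add_row_mx -scalerDl; congr row_mx.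
by rewrite addrCA subrr addr0 scale1r.
Qed.

Lemma hat_shift (x : 'rV[R]_d) i a :
  hat (x + a *: delta_mx 0 i) = hat x + a *: ehat R i.
Proof. by rewrite /hat /ehat scale_row_mx add_row_mx scaler0 addr0. Qed.

(** A sublevel set of a convex function is convex, so it contains the hull of any set it
    contains. *)
Lemma conv_hull_sublevel (X : set 'rV[R]_d) (f : 'rV[R]_d -> R) a :
  (forall x y l, 0 <= l <= 1 ->
     f (l *: x + (1 - l) *: y) <= l * f x + (1 - l) * f y) ->
  (forall x, X x -> f x <= a) -> forall x, conv_hull X x -> f x <= a.
Proof.
move=> cvx Xa; apply: smallest_sub => // x y l.
move=> /set_mem /= xa /set_mem /= ya; apply/mem_set => /=.
have l0 : 0 <= l%:num by exact: ge0.
have l1 : l%:num <= 1 by exact: le1.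
have := cvx x y l%:num; rewrite l0 l1 => /(_ isT) /le_trans; apply.
have : l%:num * f x <= l%:num * a by rewrite ler_wpM2l.
have : (1 - l%:num) * f y <= (1 - l%:num) * a by rewrite ler_wpM2l ?subr_ge0.
by lra.
Qed.

(* Averaging over the two points [c + e_k] and [c - e_k] of the convex hull
   cancels the linear part [v]. *)
Lemma gain_direction (X : set 'rV[R]_d) (c : 'rV[R]_d) (i : 'I_d) th kap
    (v : 'cV[R]_(d + 1)) :
  conv_hull X (c + delta_mx 0 i) -> conv_hull X (c - delta_mx 0 i) ->
  1 <= `|pairing (ehat R i) th| -> kap < 1 ->
  exists2 x, X x & 0 < `|pairing (hat x) th| - kap - pairing (hat x - hat c) v.
Proof.
move=> Xp Xm th1 kap1; apply: contrapT => noX.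
pose f x := `|pairing (hat x) th| - kap - pairing (hat x - hat c) v.
have f0 : forall x, conv_hull X x -> f x <= 0.
  apply: conv_hull_sublevel => [x y l /andP[l0 l1]|x Xx]; last first.
    by rewrite leNgt; apply/negP => fx; apply: noX; exists x.
  rewrite /f hat_conv !pairingD !pairingZ pairingN.
  have := ler_normD (l * pairing (hat x) th) ((1 - l) * pairing (hat y) th).
  rewrite !normrM (ger0_norm l0) (@ger0_norm _ (1 - l)) ?subr_ge0 //.
  by lra.
have := f0 (c + 1 *: delta_mx 0 i); have := f0 (c + (-1) *: delta_mx 0 i).
rewrite scaleN1r scale1r => /(_ Xm) + /(_ Xp).
rewrite -(scale1r (delta_mx 0 i)) -scaleN1r scalerA mulr1 /f !hat_shift.
have sub_hat a : hat c + a *: ehat R i - hat c = a *: ehat R i by rewrite addrC addKr.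
rewrite !sub_hat !pairingD !pairingZ.
set q := pairing (hat c) th; set r := pairing (ehat R i) th.
(* The absolute values at the two points sum to at least [2 |r| >= 2], which exceeds [2 kap]. *)
have := ler_normB (q + 1 * r) (q + -1 * r).
have -> : q + 1 * r - (q + -1 * r) = 2 * r by ring.
rewrite normrM ger0_norm //; lra.
Qed.

End Lifting.

(** * The ascent: raising the gain of a functional while some colours stay frozen *)

Section Ascent.
Variables (R : realType) (d n m : nat) (U : finType).
Variables (P : 'I_n -> 'I_m -> 'rV[R]_d) (c : 'I_n -> 'rV[R]_d).
Variables (b : U -> 'rV[R]_(d + 1)) (kap : U -> R).
Variables (F : 'rV[R]_(d + 1)) (th : 'cV[R]_(d + 1)) (k0 : 'I_d).
Variables (A : {set 'I_n}) (p0 : {ffun 'I_n -> 'I_m}) (N0 eps : R).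
Local Notation T := ('I_n + U)%type.
Implicit Types (p : {ffun 'I_n -> 'I_m}) (s : T -> R).

Definition state_vec p (t : T) : 'rV[R]_(d + 1) :=
  match t with inl i => hat (P i (p i)) | inr u => - b u end.

Definition gain_coef p (t : T) : R :=
  if t is inl i then `|pairing (hat (P i (p i))) th| else 0.

Definition cost_coef (t : T) : R := if t is inr u then kap u else 0.

Definition mass_coef (t : T) : R := if t is inr _ then 1 else 0.

Definition state_err p s : 'rV[R]_(d + 1) := F + lincomb (state_vec p) s.

Local Notation gain p := (linform (gain_coef p)).
Local Notation cost := (linform cost_coef).
Local Notation mass := (linform mass_coef).

Hypothesis n_ge : (d + d <= n)%N.
Hypothesis hull : forall i k, conv_hull (range (P i)) (c i + delta_mx 0 k) /\
  conv_hull (range (P i)) (c i - delta_mx 0 k).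
Hypothesis kap_gt0 : forall u, 0 < kap u.
Hypothesis enterable : forall j, exists2 u, b u = hat (c j) & kap u < 1.
Hypothesis th_ge1 : 1 <= `|pairing (ehat R k0) th|.
Hypothesis eps_gt0 : 0 < eps.

(** The cost bounds the centre weights because each [kap u] is positive. Lifted points have last
    coordinate 1, so that coordinate of the error then bounds the colour weights. Strictness keeps
    the upper box constraint inactive. *)
Lemma state_bounded delta C : exists B, forall p s, (forall t, 0 <= s t) ->
  sqnorm (state_err p s) <= delta -> cost s <= C -> forall t, s t < B.
Proof.
pose Bu := \sum_u `|C| / kap u.
pose B := 1 + delta + `|F 0 (rshift d 0)| + Bu * \sum_u `|b u 0 (rshift d 0)|.
have Bu0 : 0 <= Bu by apply: sumr_ge0 => u _; rewrite divr_ge0 // ltW.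
exists (1 + Bu + `|B|) => p s s0 errs costs.
have su u : s (inr u) <= Bu.
  apply: (@le_trans _ _ (`|C| / kap u)); last first.
    by rewrite /Bu (bigD1 u) //= lerDl sumr_ge0 // => i _; rewrite divr_ge0 // ltW.
  rewrite ler_pdivlMr //; apply: le_trans (le_trans costs (ler_norm _)).
  rewrite /linform (bigD1 (inr u)) //= lerDl sumr_ge0 // => -[i|v] _ /=.
    by rewrite mulr0.
  by rewrite mulr_ge0 // ltW.
case=> [i|u]; last by apply: le_lt_trans (su u) _; have := normr_ge0 B; lra.
have : \sum_i s (inl i) <= B.
  have : state_err p s 0 (rshift d 0) <= 1 + delta.
    by apply: le_trans (coord_le_sqnorm _ _) _; lra.
  rewrite mxE lincomb_coord /linform big_sumType /=.
  under eq_bigr do rewrite hat_last mulr1.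
  have : \sum_u s (inr u) * (- b u) 0 (rshift d 0) >=
      - (Bu * \sum_u `|b u 0 (rshift d 0)|).
    rewrite mulr_sumr -sumrN; apply: ler_sum => u _; rewrite mxE mulrN lerN2.
    apply: (@le_trans _ _ (s (inr u) * `|b u 0 (rshift d 0)|)).
      by rewrite ler_wpM2l // ler_norm.
    by rewrite ler_wpM2r.
  have := ler_norm (- F 0 (rshift d 0)); rewrite normrN /B; lra.
rewrite (bigD1 i) //=.
have : 0 <= \sum_(j < n | j != i) s (inl j) by exact: sumr_ge0.
have := ler_norm B; lra.
Qed.

Lemma support_card s : (#|[set t | s t != 0%R]%SET| =
  #|[set i | s (inl i) != 0%R]%SET| + #|[set u | s (inr u) != 0%R]%SET|)%N.
Proof.
rewrite -!sum1_card big_mkcond big_sumType /=; congr (_ + _)%N;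
by rewrite [RHS]big_mkcond; apply: eq_bigr => i _; rewrite !inE.
Qed.

(** If every colour outside [A] were active, then [2 d <= n <= #|A| + (d + 1) - (active centres)],
    against the second hypothesis. *)
Lemma spare_colour s : (#|[set t | s t != 0%R]%SET| <= d + 1)%N ->
  (#|A| + 1 < d + #|[set u | s (inr u) != 0%R]%SET|)%N ->
  exists2 j, j \notin A & s (inl j) = 0.
Proof.
rewrite support_card => le1 lt2.
have [j /andP[jA /eqP sj]|noj] := pickP (fun j => (j \notin A) && (s (inl j) == 0)).
  by exists j.
have : (n <= #|A| + #|[set i | s (inl i) != 0%R]%SET|)%N.
  rewrite -[X in (X <= _)%N]card_ord -cardsT.
  apply: leq_trans (leq_card_setU _ _); apply: subset_leq_card.
  apply/fintype.subsetP => i _; rewrite !inE.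
  by have := noj i; case: (i \in A) => //= /negbT.
lia.
Qed.

Definition penalised Mc p s : R := gain p s - cost s - Mc * sqnorm (state_err p s).

(** Capping the gain at [eps] bounds cost and penalty of a maximiser when it is compared with the
    starting state. *)
Definition admissible B p s : Prop :=
  [/\ forall i, i \in A -> p i = p0 i, forall t, 0 <= s t <= B, N0 <= mass s &
    gain p s <= eps].

Lemma state_errD p s e h :
  state_err p (fun t => s t + h * e t) = state_err p s + h *: lincomb (state_vec p) e.
Proof. by rewrite /state_err lincombD addrA. Qed.

Lemma penalisedD Mc p s e h :
  penalised Mc p (fun t => s t + h * e t) = penalised Mc p s
    + h * (gain p e - cost e
           - Mc * (2 * pairing (lincomb (state_vec p) e) (state_err p s)^T))
    - h ^+ 2 * (Mc * sqnorm (lincomb (state_vec p) e)).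
Proof. by rewrite /penalised !linformD state_errD sqnormD; ring. Qed.

Lemma feasible_direction B p s e :
  (forall i, i \in A -> p i = p0 i) -> (forall t, 0 <= s t < B) ->
  N0 < mass s -> gain p s < eps -> (forall t, s t = 0 -> 0 <= e t) ->
  exists2 h, 0 < h & forall h', 0 <= h' <= h ->
    admissible B p (fun t => s t + h' * e t).
Proof.
move=> pA sB sN sg e0.
(* One index per inequality: lower bounds, upper bounds, mass, gain. At a zero weight the lower
   bound becomes a trivial constraint, since [e0] already keeps that weight nonnegative. *)
pose a (x : T + T + bool) := match x with
  | inl (inl t) => if s t == 0 then 1 else s t
  | inl (inr t) => B - s t
  | inr true => mass s - N0 | inr false => eps - gain p s end.
pose e' (x : T + T + bool) := match x with
  | inl (inl t) => if s t == 0 then 0 else e t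
  | inl (inr t) => - e t
  | inr true => mass e | inr false => - gain p e end.
have [|h h0 hP] := @small_step R _ a e'.
  case=> [[t|t]|[]] /=; rewrite ?subr_gt0 //; last by have /andP[] := sB t.
  by case: eqP => // /eqP st; rewrite lt_neqAle eq_sym st; have /andP[] := sB t.
exists h => // h' h'h; split => //.
- move=> t; have := hP h' h'h (inl (inl t)); have := hP h' h'h (inl (inr t)).
  rewrite /=; have /andP[h'0 _] := h'h; case: eqP => [st0 h1 _|_]; last by lra.
  have := mulr_ge0 h'0 (e0 t st0); rewrite st0 add0r => ->/=.
  by rewrite st0 in h1; lra.
- by rewrite linformD; have := hP h' h'h (inr true); rewrite /=; lra.
- by rewrite linformD; have := hP h' h'h (inr false); rewrite /=; lra.
Qed.

Local Notation V := (prod_topology (fun _ : T => (R : topologicalType))).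

Lemma sqnorm_err_continuous p : continuous (fun s : V => sqnorm (state_err p s)).
Proof.
pose q j (s : V) := F 0 j + linform (fun t => state_vec p t 0 j) s.
have -> : (fun s : V => sqnorm (state_err p s)) = (fun s => \sum_j (q j s * q j s)).
  by apply/funext => s; apply: eq_bigr => j _; rewrite mxE lincomb_coord expr2.
have cq j : continuous (q j).
  by apply: continuousD_fun; [exact: cst_continuous|exact: linform_continuous].
by apply: continuous_sum_fun => j; exact: continuousM_fun.
Qed.

Lemma penalised_continuous Mc p : continuous (fun s : V => penalised Mc p s).
Proof.
apply: continuousD_fun.
  apply: continuousD_fun; first exact: linform_continuous.
  by apply: continuousN_fun; exact: linform_continuous.
apply: continuousN_fun; apply: continuousM_fun; first exact: cst_continuous.
exact: sqnorm_err_continuous.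
Qed.

Lemma admissible_closed p :
  closed ([set s : V | N0 <= mass s] `&` [set s : V | gain p s <= eps]).
Proof.
apply: closedI; first by apply: closed_superlevel; exact: linform_continuous.
by apply: closed_sublevel; exact: linform_continuous.
Qed.

(* Among the maximisers of the penalised gain, one that also maximises the
   strictly convex sum of squares cannot be moved along a null direction. *)
Lemma admissible_max B Mc : (exists p s, admissible B p s) ->
  exists p s, [/\ admissible B p s,
    forall p' s', admissible B p' s' -> penalised Mc p' s' <= penalised Mc p s &
    forall s', admissible B p s' -> penalised Mc p s <= penalised Mc p s' ->
      \sum_t s' t * s' t <= \sum_t s t * s t].
Proof.
move=> ne; have [|p [s [[pA sB sN sg] smax]]] :=
    @finite_family_max R _ _ (penalised Mc) (fun p => [set s | admissible B p s]) _ ne.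
  move=> p [s [pA sB sN sg]].
  have [|s' [s'B [s'N s'g] s'max]] := @box_max R _ B (fun s : V => penalised Mc p s)
    _ (@penalised_continuous Mc p) (@admissible_closed p).
    by exists s.
  exists s'; first by split.
  by move=> s2 [p2 s2B s2N s2g]; apply: s'max.
have [|||s' [s'B [[s'N s'g] s'P] s'max]] := @box_max R _ B (fun s : V => \sum_t s t * s t)
    (([set s : V | N0 <= mass s] `&` [set s : V | gain p s <= eps]) `&`
     [set s' : V | penalised Mc p s <= penalised Mc p s']).
- by apply: continuous_sum_fun => t; apply: continuousM_fun; exact: coordinate_continuous.
- apply: closedI; first exact: admissible_closed.
  by apply: closed_superlevel; exact: penalised_continuous.
- by exists s => //; split => //=.
exists p, s'; split => //.
- by move=> p2 s2 /smax /le_trans; apply.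
- move=> s2 [p2 s2B s2N s2g] s2P; apply: s'max => //; split => //=.
  exact: le_trans s2P.
Qed.

(** A null direction leaves the error unchanged, so by maximality the steps [h] and [-h] both
    preserve the penalised gain. The two resulting sums of squares average to more than the present
    one, so one of them exceeds it. *)
Lemma maximiser_support B Mc p s : admissible B p s ->
  (forall t, s t < B) -> N0 < mass s -> gain p s < eps ->
  (forall p' s', admissible B p' s' -> penalised Mc p' s' <= penalised Mc p s) ->
  (forall s', admissible B p s' -> penalised Mc p s <= penalised Mc p s' ->
      \sum_t s' t * s' t <= \sum_t s t * s t) ->
  (#|[set t | s t != 0%R]%SET| <= d + 1)%N.
Proof.
move=> [pA sB0 _ _] sB sN sg smax sqmax; rewrite leqNgt; apply/negP => /null_direction.
move=> /(_ _ (state_vec p)) [e [[t0 et0] eS ze]].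
have sB' t : 0 <= s t < B by rewrite sB; have /andP[-> _] := sB0 t.
have es t : s t = 0 -> e t = 0 by move=> st; apply: eS; rewrite inE st eqxx.
have [|h1 h10 h1P] := @feasible_direction B p s e pA sB' sN sg.
  by move=> t /es ->.
have [|h2 h20 h2P] := @feasible_direction B p s (fun t => - e t) pA sB' sN sg.
  by move=> t /es ->; rewrite oppr0.
pose h := Num.min h1 h2.
have h0 : 0 < h by rewrite lt_min h10 h20.
have Ap : admissible B p (fun t => s t + h * e t).
  by apply: h1P; rewrite ltW // ge_min lexx.
have Am : admissible B p (fun t => s t + (- h) * e t).
  rewrite (_ : (fun t => _) = (fun t => s t + h * - e t)); last first.
    by apply/funext => t; rewrite mulrN mulNr.
  by apply: h2P; rewrite ltW // ge_min lexx orbT.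
have sq0 : sqnorm (0 : 'rV[R]_(d + 1)) = 0.
  by rewrite /sqnorm big1 // => j _; rewrite mxE expr0n.
have := sqmax _ Ap; have := sqmax _ Am; have := smax _ _ Ap; have := smax _ _ Am.
rewrite !penalisedD ze pairing0 sq0 !mulr0 !subr0.
set D := gain p e - cost e => DM DP.
have {}DM : 0 <= h * D by lra.
have {}DP : h * D = 0 by lra.
rewrite DP mulNr DP subr0 addr0 => /(_ (lexx _)) + /(_ (lexx _)).
have sqD a : \sum_t (s t + a * e t) * (s t + a * e t) =
    \sum_t s t * s t + a * (\sum_t 2 * s t * e t) + a ^+ 2 * \sum_t e t ^+ 2.
  by rewrite !mulr_sumr -!big_split; apply: eq_bigr => t _ /=; ring.
rewrite !sqD.
have e2 : 0 < \sum_t e t ^+ 2.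
  rewrite (bigD1 t0) //= ltr_wpDr ?sumr_ge0 // => [t _|]; first exact: sqr_ge0.
  by rewrite lt_neqAle eq_sym sqrf_eq0 et0 sqr_ge0.
have : 0 < h ^+ 2 * \sum_t e t ^+ 2 by rewrite mulr_gt0 // exprn_gt0.
rewrite sqrrN; lra.
Qed.

(** Colour [j] and the centre [hat (c j)] receive weight at the same rate. The first-order change is
    the quantity that [gain_direction] makes positive for some point of colour [j]; switching to
    that point is free because the weight of [j] is 0. *)
Lemma maximiser_enter B Mc p s j : 0 < Mc -> admissible B p s ->
  (forall t, s t < B) -> N0 < mass s -> gain p s < eps ->
  j \notin A -> s (inl j) = 0 ->
  exists p' s', admissible B p' s' /\ penalised Mc p s < penalised Mc p' s'.
Proof.
move=> Mc0 [pA sB0 _ _] sB sN sg jA sj.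
have [u bu ku] := enterable j; have [Hp Hm] := hull j k0.
have [_ [k _ <-] gk] := gain_direction ((2 * Mc) *: (state_err p s)^T) Hp Hm th_ge1 ku.
pose p' := [ffun i => if i == j then k else p i].
have p'N i : i != j -> p' i = p i by rewrite ffunE => /negbTE ->.
have sumE (V : lmodType R) (z z' : T -> V) :
    (forall t, t != inl j -> z t = z' t) -> lincomb z s = lincomb z' s.
  move=> zz'; apply: eq_bigr => t _; have [->|tj] := eqVneq t (inl j).
    by rewrite sj !scale0r.
  by rewrite zz'.
have vecE t : t != inl j -> state_vec p' t = state_vec p t.
  by case: t => //= i ij; rewrite p'N.
have gainE : gain p' s = gain p s.
  by apply: (sumE R^o) => -[i ij|//] /=; rewrite p'N.
have errE : state_err p' s = state_err p s by rewrite /state_err (sumE _ _ _ vecE).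
pose e (t : T) : R := (t == inl j)%:R + (t == inr u)%:R.
have eE (V : lmodType R) (z : T -> V) : lincomb z e = z (inl j) + z (inr u).
  rewrite /lincomb (bigD1 (inl j)) //= (bigD1 (inr u)) //= big1.
    by rewrite /e eqxx /= eqxx addr0 add0r !scale1r addr0.
  by move=> t /andP[tj tu]; rewrite /e (negbTE tj) (negbTE tu) addr0 scale0r.
have formE (g : T -> R) : linform g e = g (inl j) + g (inr u) by exact: (eE R^o).
have [|||||h h0 hP] := @feasible_direction B p' s e.
- by move=> i iA; rewrite ffunE; case: eqP => [ij|_]; [rewrite -ij iA in jA|exact: pA].
- by move=> t; rewrite sB; have /andP[-> _] := sB0 t.
- exact: sN.
- by rewrite gainE.
- by move=> t _; rewrite addr_ge0.
pose D := gain p' e - cost e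
  - Mc * (2 * pairing (lincomb (state_vec p') e) (state_err p' s)^T).
pose q := Mc * sqnorm (lincomb (state_vec p') e).
have D0 : 0 < D.
  rewrite /D errE.
  have -> : gain p' e = `|pairing (hat (P j k)) th|.
    by rewrite formE /= ffunE eqxx addr0.
  have -> : cost e = kap u by rewrite formE /= add0r.
  have -> : lincomb (state_vec p') e = hat (P j k) - hat (c j).
    by rewrite eE /= ffunE eqxx bu.
  move: gk; rewrite pairingZr; lra.
have q0 : 0 <= q by rewrite mulr_ge0 ?sqnorm_ge0 // ltW.
(* Short enough for the linear gain to beat the quadratic loss [q]; the [+ 1] guards against
   [q = 0]. *)
pose h' := Num.min h (D / (q + 1) / 2).
have Dq0 : 0 < D / (q + 1) / 2 by rewrite !divr_gt0 //; lra.
have h'0 : 0 < h' by rewrite lt_min h0.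
exists p', (fun t => s t + h' * e t); split.
  by apply: hP; rewrite ltW // ge_min lexx.
rewrite penalisedD -/D -/q.
have -> : penalised Mc p' s = penalised Mc p s by rewrite /penalised gainE errE.
have h'q : h' * (q + 1) <= D / 2.
  have : h' <= D / (q + 1) / 2 by rewrite ge_min lexx orbT.
  move=> h'D; apply: (@le_trans _ _ (D / (q + 1) / 2 * (q + 1))).
    by rewrite ler_wpM2r //; lra.
  by rewrite le_eqVlt; apply/orP; left; apply/eqP; field; lra.
have : 0 < h' * (D - h' * q) by apply: mulr_gt0 => //; lra.
by rewrite expr2; lra.
Qed.

(** By the hypothesis on states of small error, a maximiser has only strict constraints, hence small
    support and a spare colour, whose entry would improve it. *)
Lemma ascent_core (s0 : T -> R) delta :
  (forall t, 0 <= s0 t) -> state_err p0 s0 = 0 -> N0 <= mass s0 ->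
  gain p0 s0 <= eps -> 0 < delta ->
  (forall p s, (forall i, i \in A -> p i = p0 i) -> (forall t, 0 <= s t) ->
     sqnorm (state_err p s) < delta -> cost s <= cost s0 + eps ->
     N0 <= mass s -> gain p s <= eps ->
     [/\ gain p s < eps, N0 < mass s &
       (#|A| + 1 < d + #|[set u | s (inr u) != 0%R]%SET|)%N]) -> False.
Proof.
move=> s00 s0E s0N s0g delta0 good.
have cost0 s : (forall t, 0 <= s t) -> 0 <= cost s.
  move=> spos; apply: linform_ge0 => // -[i|u] //=; exact: ltW.
have sq0 : sqnorm (0 : 'rV[R]_(d + 1)) = 0.
  by rewrite /sqnorm big1 // => j _; rewrite mxE expr0n.
have cs0 := cost0 _ s00; have eps0 := eps_gt0.
(* Comparison with [s0] bounds the penalty by [eps + cost s0], which is below [Mc * delta]. *)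
pose Mc := (eps + cost s0 + 1) / delta.
have Mc0 : 0 < Mc by rewrite divr_gt0 //; lra.
have [B Bb] := state_bounded delta (cost s0 + eps).
have s0B t : s0 t < B by apply: (Bb p0) => //; [rewrite s0E sq0|rewrite lerDl]; exact: ltW.
have adm0 : admissible B p0 s0 by split => // t; rewrite s00 ltW.
have [|p [s [adm smax sqmax]]] := @admissible_max B Mc; first by exists p0, s0.
have [pA sB sN sg] := adm.
have s_ge0 t : 0 <= s t by have /andP[] := sB t.
have Phi := smax _ _ adm0.
have g0 : 0 <= gain p0 s0 by apply: linform_ge0 => // -[i|u] //=.
have e0 := sqnorm_ge0 (state_err p s).
have Me0 : 0 <= Mc * sqnorm (state_err p s) by rewrite mulr_ge0 // ltW.
move: Phi; rewrite /penalised s0E sq0 mulr0 subr0 => Phi.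
have scost : cost s <= cost s0 + eps by lra.
have serr : sqnorm (state_err p s) < delta.
  have Md : Mc * delta = eps + cost s0 + 1 by rewrite /Mc divfK ?gt_eqF.
  by rewrite -(ltr_pM2l Mc0) Md; have := cost0 _ s_ge0; lra.
have [sg' sN' scount] := good p s pA s_ge0 serr scost sN sg.
have slt t : s t < B by apply: (Bb p) => //; exact: ltW.
have supp := maximiser_support adm slt sN' sg' smax sqmax.
have [j jA sj] := spare_colour supp scount.
have [p' [s' [/smax + lt]]] := maximiser_enter Mc0 adm slt sN' sg' jA sj.
by rewrite leNgt lt.
Qed.

(** The ways in which the three conclusions asked for by [ascent_core] can fail. A small centre
    support is phrased as vanishing outside a set [L], a closed condition for each of the finitely
    many [L]. *)
Definition terminal_condition p (x : bool + {set U}) : set V :=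
  match x with
  | inl true => [set s : V | eps <= gain p s]
  | inl false => [set s : V | mass s <= N0] `&` [set s : V | gain p s <= eps]
  | inr L => [set s : V | linform (fun t => if t is inr u then (u \notin L)%:R else 0) s <= 0]
      `&` [set s : V | gain p s <= eps]
  end.

Lemma terminal_closed p x : closed (terminal_condition p x).
Proof.
case: x => [[]|L]; last apply: closedI.
- by apply: closed_superlevel; exact: linform_continuous.
- by apply: closedI; apply: closed_sublevel; exact: linform_continuous.
- by apply: closed_sublevel; exact: linform_continuous.
- by apply: closed_sublevel; exact: linform_continuous.
Qed.

(* By compactness the residual error is bounded away from zero on the states
   that stop the ascent. *)
Lemma ascent (s0 : T -> R) :
  (forall t, 0 <= s0 t) -> state_err p0 s0 = 0 -> N0 <= mass s0 ->
  (forall p s, (forall i, i \in A -> p i = p0 i) -> (forall t, 0 <= s t) ->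
     state_err p s = 0 -> cost s <= cost s0 + eps ->
     N0 <= mass s -> gain p s <= eps ->
     N0 < mass s /\ (#|A| + 1 < d + #|[set u | s (inr u) != 0%R]%SET|)%N) ->
  exists p s, [/\ forall i, i \in A -> p i = p0 i, forall t, 0 <= s t,
     state_err p s = 0, cost s <= cost s0 + eps & N0 <= mass s /\ eps <= gain p s].
Proof.
move=> s00 s0E s0N good; apply: contrapT => nogoal.
have s0g : gain p0 s0 <= eps.
  rewrite leNgt; apply/negP => s0g; apply: nogoal; exists p0, s0.
  by split => //; [rewrite lerDl ltW|split => //; exact: ltW].
have [B Bb] := state_bounded 1 (cost s0 + eps).
pose K (px : {ffun 'I_n -> 'I_m} * (bool + {set U})) : set V :=
  [set s | [/\ forall i, i \in A -> px.1 i = p0 i,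
     if px.2 is inr L then (#|L| + d <= #|A| + 1)%N else true, forall t, 0 <= s t <= B,
     cost s <= cost s0 + eps & N0 <= mass s /\ terminal_condition px.1 px.2 s]].
have K_err px s : K px s -> state_err px.1 s != 0.
  case: px => p x [/= pA xL sB sc [sN sx]]; apply/eqP => sE.
  have s_ge0 t : 0 <= s t by have /andP[] := sB t.
  have [gle|ggt] := leP (gain p s) eps; last first.
    by apply: nogoal; exists p, s; split => //; split => //; exact: ltW.
  have [sN' sc'] := good p s pA s_ge0 sE sc sN gle.
  case: x xL sx => [[] _ /= sx|L xL [/= sx _]].
  - by apply: nogoal; exists p, s.
  - by case: sx => /= sx _; rewrite ltNge sx in sN'.
  - suff : (#|[set u | s (inr u) != 0%R]%SET| <= #|L|)%N.
      by move: xL sc' => /=; clear; lia.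
    apply: subset_leq_card; apply/fintype.subsetP => u; rewrite inE.
    apply: contraNT => uL; rewrite eq_le s_ge0 andbT; apply: le_trans sx.
    rewrite /linform (bigD1 (inr u)) //= uL mulr1 lerDl sumr_ge0 // => -[i|v] _ /=.
      by rewrite mulr0.
    by rewrite mulr_ge0.
have [delta delta0 Kdelta] :
    exists2 delta, 0 < delta & forall px s, K px s -> delta <= sqnorm (state_err px.1 s).
  have [[px [s Ks]]|Kempty] := pselect (exists px s, K px s); last first.
    by exists 1 => // px s Ks; case: Kempty; exists px, s.
  have [||px' [s' [Ks' s'max]]] :=
    @finite_family_max R _ _ (fun px s => - sqnorm (state_err px.1 s)) K.
  - move=> [p x] [s1 [/= pA xL sB sc [sN sx]]].
    have [||s2 [s2B [[s2c s2N] s2x] s2max]] :=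
      @box_max R _ B (fun s : V => - sqnorm (state_err p s))
       (([set s : V | cost s <= cost s0 + eps] `&` [set s : V | N0 <= mass s])
         `&` terminal_condition p x)
       (continuousN_fun (@sqnorm_err_continuous p)).
    + apply: closedI; last exact: terminal_closed.
      by apply: closedI; [apply: closed_sublevel|apply: closed_superlevel];
        exact: linform_continuous.
    + by exists s1.
    + exists s2; first by split.
      by move=> s3 [/= _ _ s3B s3c [s3N s3x]]; apply: s2max.
  - by exists px, s.
  exists (sqnorm (state_err px'.1 s')).
    rewrite lt_neqAle sqnorm_ge0 andbT eq_sym; apply/eqP => /sqnorm_eq0 /eqP.
    by rewrite (negbTE (K_err _ _ Ks')).
  by move=> px2 s2 /s'max; rewrite lerN2.
apply: (@ascent_core s0 (Num.min 1 delta)) => //; first by rewrite lt_min ltr01.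
move=> p s pA s_ge0; rewrite lt_min => /andP[err1 errd] sc sN sg.
have sB t : 0 <= s t <= B.
  by rewrite s_ge0 ltW // (Bb p) // ltW.
have notK x : ~ K (p, x) s.
  by move=> /Kdelta; rewrite leNgt errd.
split.
- rewrite ltNge; apply/negP => sg'; apply: (notK (inl true)).
  by split.
- rewrite ltNge; apply/negP => sN'; apply: (notK (inl false)).
  by split.
- rewrite ltnNge; apply/negP => sL.
  apply: (notK (inr [set u | s (inr u) != 0%R]%SET)); split => //=.
    by rewrite addnC.
  split => //; split => //=; rewrite /linform big1 // => -[i|u] _.
    by rewrite mulr0.
  by rewrite inE negbK; case: eqP => [->|_]; rewrite ?mul0r ?mulr0.
Qed.

End Ascent.

(** * Row replacement in determinants and Cramer's rule *)

Section RowReplacement.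
Variables (R : realType) (k : nat).
Implicit Types (H M N : 'M[R]_k).

Lemma det_scale_rows M N (a : 'I_k -> R) :
  (forall r, row r N = a r *: row r M) -> \det N = (\prod_r a r) * \det M.
Proof.
move=> Na; have -> : N = diag_mx (\row_r a r) *m M.
  apply/matrixP => i j; rewrite mul_diag_mx !mxE.
  by have /rowP/(_ j) := Na i; rewrite !mxE.
by rewrite det_mulmx det_diag; congr (_ * _); apply: eq_bigr => r _; rewrite mxE.
Qed.

Lemma pairing_col M (z : 'rV[R]_k) r : pairing z (col r M) = (z *m M) 0 r.
Proof. by rewrite /pairing !mxE; apply: eq_bigr => j _; rewrite mxE. Qed.

(** Laplace expansion along row [r]: its cofactors only involve the other rows, where [N] and [H]
    agree. This form of Cramer's rule also serves singular matrices. *)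
Lemma det_replace_adj H N r : (forall r', r' != r -> row r' N = row r' H) ->
  \det N = (row r N *m \adj H) 0 r.
Proof.
move=> NH; rewrite (expand_det_row N r) mxE; apply: eq_bigr => j _.
rewrite !mxE /cofactor; congr (_ * (_ * \det _)).
apply/matrixP => i i'; rewrite !mxE.
have ri : lift r i != r by rewrite eq_sym neq_lift.
by have /rowP/(_ (lift j i')) := NH _ ri; rewrite !mxE.
Qed.

Lemma det_replace_row H N r : \det H != 0 ->
  (forall r', r' != r -> row r' N = row r' H) ->
  \det N = pairing (row r N) (col r (invmx H)) * \det H.
Proof.
move=> H0 NH; rewrite (det_replace_adj NH) pairing_col /invmx unitmxE unitfE H0.
by rewrite -scalemxAr [in RHS]mxE mulrAC mulVf // mul1r.
Qed.

Lemma pairing_row_invmx H r r' : \det H != 0 ->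
  pairing (row r' H) (col r (invmx H)) = (r' == r)%:R.
Proof.
by move=> H0; rewrite pairing_col -row_mul mulmxV ?unitmxE ?unitfE // !mxE.
Qed.

Lemma row_decomposition H (z : 'rV[R]_k) : \det H != 0 ->
  z = \sum_r pairing z (col r (invmx H)) *: row r H.
Proof.
move=> H0; have uH : H \in unitmx by rewrite unitmxE unitfE.
rewrite -[LHS](mulmxKV uH) mulmx_sum_row; apply: eq_bigr => r _.
by rewrite pairing_col.
Qed.

End RowReplacement.

(** * Configurations and the determinant potential: existence of a maximiser *)

Section Configurations.
Variables (R : realType) (d n m : nat).
Variables (P : 'I_n -> 'I_m -> 'rV[R]_d) (c : 'I_n -> 'rV[R]_d) (rho : R).
Hypothesis d_ge2 : (2 <= d)%N.
Hypothesis n_eq : n = (2 * d)%N.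
Hypothesis hull : forall i k, conv_hull (range (P i)) (c i + delta_mx 0 k) /\
  conv_hull (range (P i)) (c i - delta_mx 0 k).
Hypothesis rho_gt0 : 0 < rho.
Local Notation T := ('I_n + 'I_n)%type.
Local Notation G := ('I_n + 'I_d + 'I_n)%type.
Local Notation V := (prod_topology (fun _ : T => (R : topologicalType))).
Implicit Types (p : {ffun 'I_n -> 'I_m}) (s : T -> R) (b : {ffun 'I_(d + 1) -> G}).

Local Notation vec := (state_vec P (fun l => hat (c l))).
Local Notation mass := (linform (@mass_coef R n _)).

(** Only centre weights are normalised; the last coordinate of the balance then makes the colour
    weights total 1 as well. *)
Definition is_config p s : Prop :=
  [/\ forall t, 0 <= s t, lincomb (vec p) s = 0 & mass s = 1].

Definition row_weight s (g : G) : R :=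
  match g with inl (inl i) => s (inl i) | inl (inr _) => rho | inr l => s (inr l) end.

Definition row_dir p (g : G) : 'rV[R]_(d + 1) :=
  match g with
  | inl (inl i) => hat (P i (p i)) | inl (inr k) => ehat R k | inr l => hat (c l)
  end.

Definition is_centre (g : G) : bool := if g is inr _ then true else false.

Definition row_choice b : bool :=
  [forall r, is_centre (b r) == (r == rshift d 0)].

Definition row_mx_of p s b : 'M[R]_(d + 1) :=
  \matrix_r (row_weight s (b r) *: row_dir p (b r)).

Definition potential p s b : R := `|\det (row_mx_of p s b)|.

Lemma row_row_mx_of p s b r :
  row r (row_mx_of p s b) = row_weight s (b r) *: row_dir p (b r).
Proof. exact: rowK. Qed.

Lemma mass_sum s : mass s = \sum_l s (inr l).
Proof.
rewrite /linform big_sumType /= [X in X + _]big1 ?add0r => [|i _]; last by rewrite mulr0.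
by apply: eq_bigr => l _; rewrite mulr1.
Qed.

Lemma mass_balance p s : lincomb (vec p) s = 0 ->
  \sum_i s (inl i) = mass s.
Proof.
rewrite mass_sum => /rowP/(_ (rshift d 0)); rewrite lincomb_coord /linform big_sumType mxE /=.
under eq_bigr do rewrite hat_last mulr1.
under [X in _ + X]eq_bigr do rewrite mxE hat_last mulrN1.
by rewrite sumrN => /eqP; rewrite subr_eq0 => /eqP.
Qed.

Lemma config_normalise p s : (forall t, 0 <= s t) -> lincomb (vec p) s = 0 ->
  0 < mass s -> is_config p (fun t => (mass s)^-1 * s t).
Proof.
move=> s0 ls ms; split.
- by move=> t; rewrite mulr_ge0 // invr_ge0 ltW.
- by rewrite lincombZ ls scaler0.
- have := linformD (@mass_coef R n _) (fun=> 0) s (mass s)^-1.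
  under eq_fun do rewrite add0r.
  move=> ->; rewrite mulVf ?gt_eqF // [X in X + _]big1 ?add0r // => t _.
  by rewrite mul0r.
Qed.

Lemma config_le1 p s : is_config p s -> forall t, 0 <= s t <= 1.
Proof.
move=> [s0 ls ms] t; rewrite s0 /=.
have sumR : \sum_l s (inr l) = 1 by rewrite -mass_sum.
have sumL : \sum_i s (inl i) = 1 by rewrite (mass_balance ls).
case: t => i; [rewrite -sumL|rewrite -sumR]; rewrite (bigD1 i) //= lerDl;
  exact: sumr_ge0.
Qed.

Lemma config_exists (p0 : {ffun 'I_n -> 'I_m}) : exists p s, is_config p s.
Proof.
have d_gt0 : (0 < d)%N by rewrite ltnW.
pose k0 := Ordinal d_gt0.
pose th : 'cV[R]_(d + 1) := delta_mx (lshift 1 k0) 0.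
have th1 : pairing (ehat R k0) th = 1.
  by rewrite /pairing -colE mxE /ehat row_mxEl mxE !eqxx.
have half01 : 0 < 2^-1 :> R by lra.
have ent j : exists2 u : 'I_n, hat (c u) = hat (c j) & 2^-1 < 1 :> R.
  by exists j => //; lra.
(* An ascent from the zero state with nothing frozen. Gain 1 forces a nonzero colour weight, hence
   positive mass; the level [-1] makes the mass constraint vacuous. *)
have [||||||p [s [_ s0 sE _ [_ sg]]]] := @ascent R d n m 'I_n P c (fun l => hat (c l))
  (fun=> 2^-1) 0 th k0 finset.set0 p0 (-1) 1 _ hull (fun=> half01) ent _ ltr01 (fun=> 0).
- by rewrite n_eq; lia.
- by rewrite th1 normr1.
- by [].
- by rewrite /state_err /lincomb big1 ?addr0 // => t _; rewrite scale0r.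
- by rewrite /linform big1 => [|t _]; rewrite ?mul0r //; lra.
- move=> p s _ s0 sE _ _ _; split.
    by apply: lt_le_trans (linform_ge0 _ s0) => [|[i|l]] //=; lra.
  by rewrite finset.cards0 add0n; apply: leq_trans (leq_addr _ _).
move: sE; rewrite /state_err add0r => sE.
exists p, (fun t => (mass s)^-1 * s t); apply: config_normalise => //.
rewrite lt_neqAle eq_sym linform_ge0 ?andbT // => [|[]//]; apply/eqP => m0.
have s_inl i : s (inl i) = 0.
  apply: (psumr_eq0P (P := predT) (F := fun i => s (inl i))) => //.
  by rewrite (mass_balance sE).
move: sg; rewrite /linform big_sumType /= !big1 ?addr0 => [|l _|i _].
- by rewrite ler10.
- by rewrite mulr0.
- by rewrite s_inl mul0r.
Qed.

Definition maximal_config p s b : Prop :=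
  [/\ is_config p s, row_choice b, 0 < potential p s b &
    forall p' s' b', is_config p' s' -> row_choice b' ->
      potential p' s' b' <= potential p s b].

Lemma potential_continuous p b : continuous (fun s : V => potential p s b).
Proof.
have -> : (fun s : V => potential p s b) = (fun s : V =>
    \prod_r `|row_weight s (b r)| * `|\det (\matrix_r row_dir p (b r))|).
  apply/funext => s; rewrite /potential.
  rewrite (@det_scale_rows _ _ (\matrix_r row_dir p (b r)) _
    (fun r => row_weight s (b r))); last by move=> r; rewrite !rowK.
  by rewrite normrM normr_prod.
apply: continuousM_fun; last exact: cst_continuous.
apply: continuous_prod_fun => r.
have cw : continuous (fun s : V => row_weight s (b r)).
  case: (b r) => [[i|k]|l] /=; try exact: coordinate_continuous.
  exact: cst_continuous.
by move=> s; exact: (@cvg_norm R R V (nbhs s) _ _ _ (cw s)).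
Qed.

Lemma config_closed p :
  closed ([set s : V | sqnorm (lincomb (vec p) s) <= 0] `&` [set s : V | mass s = 1]).
Proof.
apply: closedI; last by apply: closed_level; exact: linform_continuous.
apply: closed_sublevel.
have -> : (fun s : V => sqnorm (lincomb (vec p) s)) =
    (fun s : V => sqnorm (state_err P (fun l => hat (c l)) 0 p s)).
  by apply/funext => s; rewrite /state_err add0r.
exact: sqnorm_err_continuous.
Qed.

(** This choice of rows gives a block triangular matrix; it shows that the maximal potential is
    positive. *)
Lemma potential_eye p s l (b : {ffun 'I_(d + 1) -> G}) : 0 <= s (inr l) ->
  (forall k, b (lshift 1 k) = inl (inr k)) -> b (rshift d 0) = inr l ->
  potential p s b = rho ^+ d * s (inr l).
Proof.
move=> sl bL bR; rewrite /potential.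
have -> : row_mx_of p s b =
    block_mx rho%:M 0 (s (inr l) *: c l) (s (inr l))%:M.
  apply/row_matrixP => r; rewrite row_row_mx_of; case: (split_ordP r) => [k|k] ->.
    rewrite bL /= /ehat scale_row_mx scaler0 block_mxEv rowKu row_row_mx row0.
    congr (row_mx _ _); apply/rowP => j; rewrite !mxE.
    by rewrite eqxx eq_sym mulr_natr.
  rewrite ord1 bR /= /hat scale_row_mx block_mxEv rowKd row_row_mx.
  by congr (row_mx _ _); apply/rowP => j; rewrite !mxE // mulr_natr.
have -> : \det (block_mx rho%:M 0 (s (inr l) *: c l) (s (inr l))%:M) =
    rho ^+ d * s (inr l).
  rewrite (@det_lblock R d 1 rho%:M (s (inr l) *: c l) (s (inr l))%:M).
  by rewrite !det_scalar expr1.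
by rewrite ger0_norm // mulr_ge0 // exprn_ge0 // ltW.
Qed.

Lemma maximal_config_exists (p0 : {ffun 'I_n -> 'I_m}) :
  exists p s b, maximal_config p s b.
Proof.
have [p1 [s1 [s1_ge0 s1L s1m]]] := config_exists p0.
have [l sl] : exists l, 0 < s1 (inr l).
  apply: contrapT => no; move: s1m; rewrite mass_sum big1 => [/eqP|l _].
    by rewrite eq_sym oner_eq0.
  by apply/eqP; rewrite eq_le s1_ge0 andbT leNgt; apply/negP => sl; apply: no; exists l.
pose b0 : {ffun 'I_(d + 1) -> G} :=
  [ffun r : 'I_(d + 1) =>
    (match fintype.split r with inl k => inl (inr k) | inr _ => inr l end : G)].
have splitL (k : 'I_d) : fintype.split (lshift 1 k) = inl k by exact: (unsplitK (inl k)).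
have splitR (k : 'I_1) : fintype.split (rshift d k) = inr k by exact: (unsplitK (inr k)).
have b0P : row_choice b0.
  apply/forallP => r; rewrite ffunE.
  case: (split_ordP r) => k ->; first by rewrite /= eq_lrshift.
  by rewrite /= ord1 eqxx.
have c1 : is_config p1 s1 by [].
pose K (pb : {ffun 'I_n -> 'I_m} * {ffun 'I_(d + 1) -> G}) : set V :=
  [set s | is_config pb.1 s /\ row_choice pb.2].
have [||[p b] [s [[/= cs bs] smax]]] :=
  @finite_family_max R _ _ (fun pb s => potential pb.1 s pb.2) K.
- move=> [p b] [s [cs /= bs]].
  have [|s' [s'B [/= s'L s'm] s'max]] := @box_max R _ 1 (fun s : V => potential p s b)
    _ (@potential_continuous p b) (@config_closed p).
    exists s; first exact: config_le1 cs.
    case: cs => /= s0 ls ms; split => //=; rewrite ls.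
    by rewrite /sqnorm big1 // => j _; rewrite mxE expr0n.
  exists s'.
    split => //; split => //; first by move=> t; have /andP[] := s'B t.
    by apply: sqnorm_eq0; apply/eqP; rewrite eq_le s'L sqnorm_ge0.
  move=> s2 [cs2 _]; apply: s'max; first exact: config_le1 cs2.
  case: cs2 => /= _ ls ms; split => //=; rewrite ls.
  by rewrite /sqnorm big1 // => j _; rewrite mxE expr0n.
- exists (p1, b0), s1; split => //.
exists p, s, b; split => //.
  apply: lt_le_trans (smax (p1, b0) s1 _) => //.
  rewrite (@potential_eye _ _ l) ?mulr_gt0 ?exprn_gt0 //.
  - by move=> k; rewrite ffunE splitL.
  - by rewrite ffunE splitR.
by move=> p' s' b' cs' bs'; apply: (smax (p', b')).
Qed.

End Configurations.

Lemma bernoulli_le (R : realType) (x : R) k : 0 <= x <= 1 ->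
  1 - k%:R * x <= (1 - x) ^+ k.
Proof.
move=> /andP[x0 x1]; elim: k => [|k IH]; first by rewrite mul0r subr0 expr0.
have /(_ (1 - x)) := ler_wpM2l _ IH; rewrite subr_ge0 => /(_ x1).
rewrite exprS; apply: le_trans; rewrite -natr1.
have : 0 <= k%:R * x * x by rewrite !mulr_ge0.
by nra.
Qed.

Lemma exists_large_term (R : realType) (n : nat) (f : 'I_n -> R) e :
  (0 < n)%N -> e <= \sum_i f i -> exists i, e / n%:R <= f i.
Proof.
move=> n0 ef; apply: contrapT => no.
have [i0] : exists i0 : 'I_n, true by exists (Ordinal n0).
suff : \sum_i f i < e by rewrite ltNge ef.
have -> : e = \sum_(i < n) e / n%:R.
  by rewrite sumr_const card_ord -[_ *+ n]mulr_natr divfK // pnatr_eq0 -lt0n.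
apply: ltr_sum => [|i _]; first by apply/hasP; exists i0; rewrite ?mem_index_enum.
by rewrite ltNge; apply/negP => ei; apply: no; exists i.
Qed.

(** * Consequences of maximality; no row [rho e_k] survives *)

Section MaximalConfiguration.
Variables (R : realType) (d n m : nat).
Variables (P : 'I_n -> 'I_m -> 'rV[R]_d) (c : 'I_n -> 'rV[R]_d) (rho : R).
Hypothesis d_ge2 : (2 <= d)%N.
Hypothesis n_eq : n = (2 * d)%N.
Hypothesis hull : forall i k, conv_hull (range (P i)) (c i + delta_mx 0 k) /\
  conv_hull (range (P i)) (c i - delta_mx 0 k).
Hypothesis rho_gt0 : 0 < rho.
Local Notation T := ('I_n + 'I_n)%type.
Local Notation G := ('I_n + 'I_d + 'I_n)%type.
Local Notation vec := (state_vec P (fun l => hat (c l))).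
Local Notation mass := (linform (@mass_coef R n _)).
Local Notation last := (rshift d (0 : 'I_1)).

Variables (p : {ffun 'I_n -> 'I_m}) (s : T -> R) (b : {ffun 'I_(d + 1) -> G}).
Hypothesis maximal : maximal_config P c rho p s b.

Let H := row_mx_of P c rho p s b.
(** Coordinate functional along row [r] in the basis of rows of [H]. In particular [Psi last]
    vanishes exactly on the span of the non-centre rows. *)
Let Psi r := col r (invmx H).

Ltac goal_lra := clear - d_ge2 n_eq hull rho_gt0 maximal H Psi; lra.
Ltac goal_nra := clear - d_ge2 n_eq hull rho_gt0 maximal H Psi; nra.

Definition colours : {set 'I_n} := [set i | [exists r, b r == inl (inl i)]]%SET.

Lemma maximal_ge0 t : 0 <= s t.
Proof. by case: maximal => -[s0 _ _] _ _ _; exact: s0. Qed.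

Lemma centre_last r : is_centre (b r) = (r == last).
Proof. by case: maximal => _ /forallP/(_ r)/eqP. Qed.

Lemma detH_neq0 : \det H != 0.
Proof. by case: maximal => _ _ H0 _; rewrite -normr_gt0. Qed.

Lemma Psi_row r r' : pairing (row r' H) (Psi r) = (r' == r)%:R.
Proof. exact: pairing_row_invmx detH_neq0. Qed.

Lemma weight_gt0 r : 0 < row_weight rho s (b r).
Proof.
rewrite lt_neqAle; apply/andP; split; last first.
  by case: (b r) => [[i|k]|l] /=; [exact: maximal_ge0|exact: ltW|exact: maximal_ge0].
apply/eqP => w0; have := Psi_row r r; rewrite row_row_mx_of -w0 scale0r pairing0 eqxx.
by move/eqP; rewrite eq_sym oner_eq0.
Qed.

(** Up to row scalings the competitor is [H] with row [r] replaced by [z], whose determinant is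
    [pairing z (Psi r) * \det H]. *)
Lemma exchange p' s' (b' : {ffun 'I_(d + 1) -> G}) r z (a : 'I_(d + 1) -> R) :
  is_config P c p' s' -> row_choice b' ->
  (forall k, k != r ->
     row_weight rho s' (b' k) *: row_dir P c p' (b' k) = a k *: row k H) ->
  row_weight rho s' (b' r) *: row_dir P c p' (b' r) = a r *: z ->
  `|\prod_k a k| * `|pairing z (Psi r)| <= 1.
Proof.
move=> cs' bs' ak ar; case: maximal => _ _ H0 /(_ _ _ _ cs' bs').
pose N : 'M[R]_(d + 1) := \matrix_k (if k == r then z else row k H).
rewrite /potential (@det_scale_rows _ _ N _ a); last first.
  move=> k; rewrite row_row_mx_of rowK; case: eqP => [->|/eqP kr]; first exact: ar.
  exact: ak.
rewrite (@det_replace_row _ _ H N r detH_neq0) => [|k kr]; last first.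
  by rewrite rowK (negbTE kr).
rewrite rowK eqxx !normrM mulrA => le1.
by rewrite -(ler_pM2r H0) mul1r.
Qed.

Definition replace_row r g : {ffun 'I_(d + 1) -> G} :=
  [ffun k => if k == r then g else b k].

Lemma replace_row_choice r g : is_centre g = (r == last) ->
  row_choice (replace_row r g).
Proof.
move=> gr; apply/forallP => k; rewrite ffunE.
by have [->|_] := eqVneq k r; rewrite ?gr ?centre_last.
Qed.

Lemma single_exchange r g : is_centre g = (r == last) ->
  `|pairing (row_weight rho s g *: row_dir P c p g) (Psi r)| <= 1.
Proof.
move=> gr; case: (maximal) => cs _ _ _.
have := @exchange p s (replace_row r g) r
  (row_weight rho s g *: row_dir P c p g) (fun=> 1) cs (replace_row_choice gr).
rewrite prodr_const expr1n normr1 mul1r; apply => [k kr|]; rewrite ffunE ?eqxx scale1r //.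
by rewrite (negbTE kr) row_row_mx_of.
Qed.

Lemma dir_colours (p' : {ffun 'I_n -> 'I_m}) r : (forall i, i \in colours -> p' i = p i) ->
  row_dir P c p' (b r) = row_dir P c p (b r).
Proof.
move=> pA; case E : (b r) => [[i|k]|l] //=; rewrite pA // inE.
by apply/existsP; exists r; rewrite E.
Qed.

(** If the [d - 1] other rows keep a factor [f] and the centre row a factor [fl], the new row cannot
    gain more than the reciprocal of [fl * f ^ (d - 1)]. *)
Lemma scaled_exchange (p' : {ffun 'I_n -> 'I_m}) s' r g z f fl ar :
  is_config P c p' s' -> (forall i, i \in colours -> p' i = p i) ->
  r != last -> is_centre g = false -> 0 <= f -> 0 <= fl -> 0 <= ar ->
  (forall k, k != r -> k != last -> f * row_weight rho s (b k) <= row_weight rho s' (b k)) ->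
  fl * row_weight rho s (b last) <= row_weight rho s' (b last) ->
  row_weight rho s' g *: row_dir P c p' g = ar *: z ->
  fl * (f ^+ d.-1 * (ar * `|pairing z (Psi r)|)) <= 1.
Proof.
move=> cs' pA rl gc f0 fl0 ar0 fk flast vz.
pose a k := if k == r then ar else row_weight rho s' (b k) / row_weight rho s (b k).
have := @exchange p' s' (replace_row r g) r z a cs'.
rewrite replace_row_choice ?gc ?(negbTE rl) // => /(_ isT) => ex.
have {}ex : `|\prod_k a k| * `|pairing z (Psi r)| <= 1.
  apply: ex => [k kr|]; last by rewrite ffunE eqxx vz /a eqxx.
  rewrite ffunE (negbTE kr) /a (negbTE kr) row_row_mx_of.
  by rewrite dir_colours // scalerA divfK // gt_eqF // weight_gt0.
apply: le_trans ex; rewrite !mulrA ler_wpM2r //; apply: le_trans (ler_norm _).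
have rl' := rl; rewrite eq_sym in rl'.
rewrite (bigD1 last) //= (bigD1 r) //= {1}/a (negbTE rl') [X in _ * (X * _)]/a eqxx.
rewrite -mulrA; apply: ler_pM => //; first by rewrite mulr_ge0 // exprn_ge0.
  by rewrite ler_pdivlMr // weight_gt0.
rewrite mulrC ler_wpM2l //.
have -> : f ^+ d.-1 = \prod_(k | (k != last) && (k != r)) f.
  rewrite prodr_const; congr (_ ^+ _).
  have := cardC (pred2 last r); rewrite card2 rl' card_ord => dE.
  have -> : #|[pred k | (k != last) && (k != r)]| = #|[predC pred2 last r]|.
    by apply: eq_card => k; rewrite !inE negb_or.
  by apply: (@addnI 2); rewrite [RHS]dE addn1 add2n prednK // ltnW.
apply: ler_prod => k /andP[kl kr]; rewrite f0 /a (negbTE kr) ler_pdivlMr ?weight_gt0 //.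
exact: fk.
Qed.

Lemma colours_card (D : {set 'I_(d + 1)}) :
  (forall r i, b r = inl (inl i) -> r \in D) -> (#|colours| <= #|D|)%N.
Proof.
move=> bD; have [->|[i0 _]] := set_0Vmem colours; first by rewrite finset.cards0.
pose f r := if b r is inl (inl i) then i else i0.
apply: leq_trans (leq_imset_card f D); apply: subset_leq_card.
apply/fintype.subsetP => i; rewrite inE => /existsP[r /eqP br].
by apply/imsetP; exists r; [exact: bD br|rewrite /f br].
Qed.

Lemma colour_row i : i \in colours -> exists2 r, b r = inl (inl i) & r != last.
Proof.
rewrite inE => /existsP[r /eqP br]; exists r => //.
by rewrite -centre_last br.
Qed.

Lemma colour_functional0 r (i : 'I_n) : i \in colours ->
  (forall r', b r' = inl (inl i) -> r' != r) ->
  pairing (hat (P i (p i))) (Psi r) = 0.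
Proof.
move=> /colour_row[r' br' _] /(_ _ br') rr'.
have := Psi_row r r'; rewrite row_row_mx_of br' /= pairingZ (negbTE rr') => /eqP.
by rewrite mulf_eq0 => /orP[/eqP s0|/eqP//]; have := weight_gt0 r'; rewrite br' /= s0 ltxx.
Qed.

(** Its combination is the [F] of the ascents below. The amount [y] is half of the centre weight in
    the first ascent and 0 in the second, where mixed centres protect [c l]. *)
Definition frozen l y (t : T) : R :=
  match t with
  | inl i => if i \in colours then s (inl i) else 0
  | inr l' => if l' == l then y else 0
  end.

Lemma frozen_vec (p' : {ffun 'I_n -> 'I_m}) l y : (forall i, i \in colours -> p' i = p i) ->
  lincomb (vec p') (frozen l y) = lincomb (vec p) (frozen l y).
Proof.
move=> pA; apply: eq_bigr => -[i|l'] _ //=.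
by case: ifP => [/pA ->|]; rewrite ?scale0r.
Qed.

(** [Psi r0] vanishes on the colours of the matrix, so the gain comes from another colour. Putting
    it in row [r0] multiplies the determinant by at least [2 f ^ (d + 1) >= 5/4], the halved centre
    row included. *)
Lemma eye_row_absurd r0 k0 : rho = (64 * d%:R ^+ 2)^-1 -> b r0 != inl (inr k0).
Proof.
move=> rhoE; apply/eqP => br0.
have r0l : r0 != last by rewrite -centre_last br0.
have [l bl] : exists l, b last = inr l.
  by have := centre_last last; rewrite eqxx; case: (b last) => // l _; exists l.
have sl : 0 < s (inr l) by have := weight_gt0 last; rewrite bl.
have d0 : 0 < d%:R :> R by rewrite ltr0n ltnW.
have d2 : 2 <= d%:R :> R by rewrite (ler_nat R 2).
have cA : (#|colours| + 1 <= d)%N.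
  pose D : {set 'I_(d + 1)} := [set last; r0]%SET.
  have : (#|colours| <= #|~: D|)%N.
    apply: colours_card => r i br; rewrite !inE negb_or -centre_last br /=.
    by apply/eqP => r0E; rewrite r0E br0 in br.
  have := finset.cardsC D; rewrite card_ord cards2 eq_sym r0l /= => DC; lia.
pose y := s (inr l) / 2; have y0 : 0 < y by rewrite divr_gt0.
have s_le1 t : s t <= 1.
  by case: maximal => /config_le1/(_ t)/andP[].
have y_le : y <= 2^-1 by rewrite /y; have := s_le1 (inr l); lra.
pose F := lincomb (vec p) (frozen l y).
(* Scaled to take the value 1 on [ehat R k0], since row [r0] is [rho *: ehat R k0]. *)
pose th := rho *: Psi r0.
(* Then [eps / (2 d rho) = 4], and [d eps = 1/8] keeps the normalisation loss [f ^ (d + 1)] above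
   5/8. *)
pose eps : R := (8 * d%:R)^-1.
have eps0 : 0 < eps by rewrite invr_gt0 mulr_gt0.
have epsd : d%:R * eps = 8^-1 by rewrite /eps; field; lra.
have mass_frozen : mass (frozen l y) = y.
  rewrite mass_sum (bigD1 l) //= eqxx big1 ?addr0 // => l' /negbTE l'l.
  by rewrite /= l'l.
have frozen_ge0 t : 0 <= frozen l y t.
  by case: t => i /=; case: ifP => // _; [exact: maximal_ge0|exact: ltW].
pose s0 t := s t + (-1) * frozen l y t.
have half01 : 0 < 2^-1 :> R by lra.
have ent j : exists2 u : 'I_n, hat (c u) = hat (c j) & 2^-1 < 1 :> R.
  by exists j => //; lra.
have costE (s2 : T -> R) : linform (cost_coef (fun=> 2^-1)) s2 = 2^-1 * mass s2.
  rewrite /linform mulr_sumr; apply: eq_bigr => -[i|u] _ /=; first by rewrite !mulr0.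
  by rewrite mulr1 mulrC.
have smass : mass s = 1 by case: maximal => -[].
have slin : lincomb (vec p) s = 0 by case: maximal => -[].
have mass0 : mass s0 = 1 - y by rewrite /s0 linformD smass mass_frozen; lra.
have total (p' : {ffun 'I_n -> 'I_m}) s2 : (forall i, i \in colours -> p' i = p i) ->
    (forall t, 0 <= s2 t) -> state_err P (fun l => hat (c l)) F p' s2 = 0 ->
    is_config P c p' (fun t => (mass s2 + y)^-1 * (s2 t + 1 * frozen l y t)).
  move=> pA s20 s2E.
  have massE : mass (fun t => s2 t + 1 * frozen l y t) = mass s2 + y.
    by rewrite linformD mass_frozen mul1r.
  rewrite -massE; apply: config_normalise.
  - by move=> t; rewrite mul1r addr_ge0.
  - by rewrite lincombD frozen_vec // scale1r addrC.
  - by rewrite massE ltr_wpDl // linform_ge0 // => -[].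
have [||||||p' [s2 [pA s20 s2E s2c [_ s2g]]]] :=
  @ascent R d n m 'I_n P c (fun l => hat (c l))
  (fun=> 2^-1) F th k0 colours p (-1) eps _ hull (fun=> half01) ent _ eps0 s0.
- by rewrite n_eq mul2n addnn.
- have := Psi_row r0 r0; rewrite row_row_mx_of br0 /= eqxx pairingZ => e1.
  by rewrite /th pairingZr e1 normr1.
- move=> [i|l']; rewrite /s0 /=.
    by case: ifP => _; [rewrite mulN1r subrr|rewrite mulr0 addr0 maximal_ge0].
  by case: eqP => [->|_]; [rewrite /y; lra|rewrite mulr0 addr0 maximal_ge0].
- by rewrite /state_err /s0 lincombD slin scaleN1r add0r subrr.
- by rewrite mass0; lra.
- move=> p' s2 pA s20 s2E _ _ _; split.
    by apply: lt_le_trans (linform_ge0 _ s20) => [|[]] //; lra.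
  rewrite ltnNge; apply/negP => small.
  have s2u u : s2 (inr u) = 0.
    have : (#|[set u | s2 (inr u) != 0%R]%SET| = 0)%N by move: small cA; clear; lia.
    move/eqP; rewrite cards_eq0 => /eqP/setP/(_ u); rewrite !inE.
    by move/negbFE/eqP.
  have m0 : mass s2 = 0 by rewrite mass_sum big1.
  have [i iA] : exists i, i \in colours by apply/card_gt0P; move: small cA d_ge2; clear; lia.
  have [r br rl] := colour_row iA.
  have := total _ _ pA s20 s2E; rewrite m0 add0r => cs'.
  have yi : 2 <= y^-1 by rewrite -[2]invrK lef_pV2 ?posrE.
  have si : 0 < s (inl i) by have := weight_gt0 r; rewrite br.
  pose ar := y^-1 * (s2 (inl i) + 1 * frozen l y (inl i)) / s (inl i).
  have ar2 : 2 <= ar.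
    rewrite /ar ler_pdivlMr // ler_pM //; first exact: ltW.
    by rewrite /= iA mul1r lerDr.
  have frozen_le t' : row_weight rho s (b t') <=
      row_weight rho (fun t => y^-1 * (s2 t + 1 * frozen l y t)) (b t') \/ t' = last.
    have [->|tl] := eqVneq t' last; [by right|left].
    have y1 : 1 <= y^-1 by lra.
    case E : (b t') => [[j|k]|j] //=; last by rewrite -centre_last E in tl.
    have -> : j \in colours by rewrite inE; apply/existsP; exists t'; rewrite E.
    rewrite -[leLHS]mul1r ler_pM //; first exact: maximal_ge0.
    by rewrite mul1r lerDr.
  have := @scaled_exchange p' _ r (inl (inl i)) (row r H) 1 1 ar cs' pA rl erefl ler01 ler01.
  rewrite Psi_row eqxx expr1n !mul1r normr1 mulr1 => /(_ (le_trans (ler0n _ 2) ar2)) ex.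
  suff : ar <= 1 by lra.
  apply: ex => [k kr kl||].
  - by rewrite mul1r; have [//|kE] := frozen_le k; rewrite kE eqxx in kl.
  - rewrite bl /= eqxx s2u add0r mul1r mulVf ?gt_eqF //; exact: s_le1.
  - rewrite row_row_mx_of br /= pA // scalerA /ar divfK ?gt_eqF //.
have n_gt0 : (0 < n)%N by move: n_eq d_ge2; clear; lia.
have nR : n%:R = 2 * d%:R :> R by rewrite n_eq natrM.
have gainE : linform (gain_coef P th p') s2 =
    \sum_i s2 (inl i) * `|pairing (hat (P i (p' i))) th|.
  by rewrite /linform big_sumType /= [X in _ + X]big1 ?addr0 // => l' _; rewrite mulr0.
rewrite gainE in s2g.
have [j gj] := exists_large_term n_gt0 s2g.
have rowl i r' : b r' = inl (inl i) -> r' != r0.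
  by move=> br'; apply/eqP => r0E; rewrite r0E br0 in br'.
have jA : j \notin colours.
  apply/negP => jA; move: gj; rewrite pA // /th pairingZr.
  rewrite (colour_functional0 jA (rowl j)) mulr0 normr0 mulr0 leNgt divr_gt0 //.
  by rewrite nR mulr_gt0.
have cs' := total _ _ pA s20 s2E.
set M := mass s2 + y in cs'.
have M0 : 0 < M by rewrite ltr_wpDl // linform_ge0 // => -[].
(* Centres cost 1/2 per unit, so a slack [eps] in cost is [2 eps] in mass. *)
have M_le : M <= 1 + 2 * eps.
  by move: s2c; rewrite !costE mass0 /M; lra.
pose f := (1 + 2 * eps)^-1.
have Mbar0 : 0 < 1 + 2 * eps by lra.
have f0 : 0 < f by rewrite invr_gt0.
have fM : f <= M^-1 by rewrite lef_pV2 ?posrE.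
have f1 : f <= 1 by rewrite invf_le1 //; lra.
have f20 : 0 <= f / 2 by rewrite divr_ge0 // ltW.
have MV0 : 0 <= M^-1 by rewrite invr_ge0 ltW.
have ex := @scaled_exchange p' _ r0 (inl (inl j)) (s2 (inl j) *: hat (P j (p' j)))
  f (f / 2) M^-1 cs' pA r0l erefl (ltW f0) f20 MV0.
have {}ex : f / 2 * (f ^+ d.-1 *
    (M^-1 * `|pairing (s2 (inl j) *: hat (P j (p' j))) (Psi r0)|)) <= 1.
  apply: ex => [k kr kl||].
  - case E : (b k) => [[i|k']|l'] /=; last by rewrite -centre_last E in kl.
      have iA : i \in colours by rewrite inE; apply/existsP; exists k; rewrite E.
      by rewrite iA mul1r ler_pM ?maximal_ge0 ?(ltW f0) // lerDr.
    by rewrite ger_pMl.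
  - rewrite bl /= eqxx mul1r; apply: (@le_trans _ _ (f * y)).
      by rewrite /y; lra.
    by rewrite ler_pM ?(ltW f0) ?(ltW y0) // lerDr.
  - by rewrite /= (negbTE jA) mulr0 addr0 scalerA.
have bern : 5 / 8 <= f ^+ d.+1.
  have fle : 1 - 2 * eps <= f.
    by rewrite /f -[leRHS]mul1r ler_pdivlMr //; goal_nra.
  have eps1 : eps <= 16^-1.
    have : 2 * eps <= 8^-1 by rewrite -epsd ler_wpM2r // ltW.
    by goal_lra.
  have e01 : 0 <= 2 * eps <= 1 by apply/andP; split; move: eps0 eps1; goal_lra.
  apply: le_trans (le_trans (bernoulli_le d.+1 e01) _).
    have -> : d.+1%:R = d%:R + 1 :> R by rewrite -natr1.
    have -> : (d%:R + 1) * (2 * eps) = 2 * (d%:R * eps) + 2 * eps by ring.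
    by rewrite epsd; move: eps1; goal_lra.
  apply: lerXn2r => //; rewrite nnegrE ?(ltW f0) //.
  by move: eps1; goal_lra.
move: gj; rewrite /th pairingZr normrM gtr0_norm // mulrCA nR => gj.
move: ex; rewrite pairingZ normrM (ger0_norm (s20 _)) => ex.
set w := s2 (inl j) * _ in gj ex.
have w4 : 4 <= w.
  have : rho^-1 * (eps / (2 * d%:R)) <= w by rewrite ler_pdivrMl // invrK.
  apply: le_trans; rewrite rhoE /eps invrK.
  by rewrite le_eqVlt; apply/orP; left; apply/eqP; field; lra.
have : f / 2 * (f ^+ d.-1 * (f * 4)) <= 1.
  apply: le_trans ex; rewrite ler_wpM2l ?divr_ge0 ?(ltW f0) //.
  rewrite ler_wpM2l ?exprn_ge0 ?(ltW f0) //.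
  by rewrite ler_pM // ltW.
have -> : f / 2 * (f ^+ d.-1 * (f * 4)) = 2 * f ^+ d.+1.
  have -> : d.+1 = (d.-1 + 2)%N by rewrite addn2 prednK // ltnW.
  by rewrite exprD expr2; move: (f ^+ d.-1) => g; goal_lra.
by move: bern; goal_lra.
Qed.

End MaximalConfiguration.

Lemma hat_sub (R : realType) (d : nat) (x y : 'rV[R]_d) :
  hat x - hat y = \sum_k (x - y) 0 k *: ehat R k.
Proof.
rewrite /hat opp_row_mx add_row_mx subrr /ehat.
rewrite (eq_bigr (fun k => row_mx ((x - y) 0 k *: delta_mx 0 k) 0)) => [|k _].
  by rewrite -(@big_morph _ _ (fun z => row_mx z 0) 0 +%R 0 +%R) -?row_sum_delta //
    => [u v|]; rewrite ?row_mx0 ?add_row_mx ?addr0.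
by rewrite scale_row_mx scaler0.
Qed.

(** [a] is the mass on mixed centres, at cost 1/16, and [b] that on pure ones, at cost 1/2; the
    ascent starts from [a = 1], [b = 0]. The price ratio 8 keeps two thirds of the mass mixed. *)
Lemma two_masses_bound (R : realType) (a b e : R) : 0 <= a -> 0 <= b -> e <= 10000^-1 ->
  16^-1 * a + 2^-1 * b <= 16^-1 * 1 + 2^-1 * 0 + e -> 2^-1 <= a + b ->
  [/\ a + b <= 1 + 16 * e, b <= 2^-1 * 3^-1 & (a + b) * 2 / 3 <= a].
Proof. by move=> a0 b0 e_le cost mass; split; lra. Qed.

(** * Mixed centres that hold a reserve on one centre *)

Section Reserve.
Variables (R : realType) (d n m : nat).
Variables (P : 'I_n -> 'I_m -> 'rV[R]_d) (c : 'I_n -> 'rV[R]_d) (l : 'I_n) (sg : R).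
Local Notation U := ('I_n + 'I_n)%type.
Implicit Types (s : 'I_n + U -> R).

(* Mixed centres keep a share [sg] of their mass on [c l]; only pure centres
   can enter an ascent, and they are made expensive. *)
Definition mixed_centre (u : U) : 'rV[R]_(d + 1) :=
  match u with
  | inl l' => sg *: hat (c l) + (1 - sg) *: hat (c l')
  | inr l' => hat (c l')
  end.

(** Splits mixed centres back into [c l] and [c l'], keeping combination and mass, so that ascent
    states yield configurations. *)
Definition merge_centres s (t : 'I_n + 'I_n) : R :=
  match t with
  | inl i => s (inl i)
  | inr l' => (1 - sg) * s (inr (inl l')) + s (inr (inr l')) +
      (if l' == l then sg * \sum_k s (inr (inl k)) else 0)
  end.

Lemma merge_centres_vec p s :
  lincomb (state_vec P (fun k => hat (c k)) p) (merge_centres s) =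
  lincomb (state_vec P mixed_centre p) s.
Proof.
rewrite /lincomb !big_sumType /=; congr (_ + _).
under eq_bigr do rewrite 2!scalerDl; rewrite 2!big_split /=.
rewrite addrAC; congr (_ + _).
rewrite [X in _ + X](bigD1 l) //= eqxx [X in _ + (_ + X)]big1 => [|k /negbTE ->]; last first.
  by rewrite scale0r.
rewrite addr0 mulr_sumr scaler_suml -big_split; apply: eq_bigr => k _ /=.
rewrite !scalerN scalerDr opprD !scalerA addrC.
by congr (- (_ *: _) - (_ *: _)); rewrite mulrC.
Qed.

Lemma mass_two s : linform (@mass_coef R n U) s =
  \sum_k s (inr (inl k)) + \sum_k s (inr (inr k)).
Proof.
rewrite /linform !big_sumType /= big1 ?add0r => [|i _]; last by rewrite mulr0.
by congr (_ + _); apply: eq_bigr => k _; rewrite mulr1.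
Qed.

Lemma cost_two (a b : R) s :
  linform (cost_coef (fun u : U => if u is inl _ then a else b)) s =
  a * (\sum_k s (inr (inl k))) + b * \sum_k s (inr (inr k)).
Proof.
rewrite /linform !big_sumType /= big1 ?add0r => [|i _]; last by rewrite mulr0.
by rewrite !mulr_sumr; congr (_ + _); apply: eq_bigr => k _; rewrite mulrC.
Qed.

Lemma merge_centres_mass s :
  linform (@mass_coef R n _) (merge_centres s) = linform (@mass_coef R n U) s.
Proof.
rewrite mass_two mass_sum /= !big_split /= addrAC; congr (_ + _).
rewrite [X in _ + X](bigD1 l) //= eqxx [X in _ + (_ + X)]big1 => [|k /negbTE -> //].
by rewrite -mulr_sumr addr0 -mulrDl addrNK mul1r.
Qed.

Lemma merge_centres_ge0 s t : 0 <= sg <= 1 -> (forall t, 0 <= s t) ->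
  0 <= merge_centres s t.
Proof.
move=> /andP[sg0 sg1] s0; case: t => [i|l'] /=; first exact: s0.
rewrite !addr_ge0 ?mulr_ge0 ?subr_ge0 //; case: eqP => // _.
by rewrite mulr_ge0 // sumr_ge0.
Qed.

End Reserve.

(** * All [d] rows are colours: one more colour far from their hyperplane *)

Section ColourRows.
Variables (R : realType) (d n m : nat).
Variables (P : 'I_n -> 'I_m -> 'rV[R]_d) (c : 'I_n -> 'rV[R]_d) (rho : R).
Hypothesis d_ge2 : (2 <= d)%N.
Hypothesis n_eq : n = (2 * d)%N.
Hypothesis hull : forall i k, conv_hull (range (P i)) (c i + delta_mx 0 k) /\
  conv_hull (range (P i)) (c i - delta_mx 0 k).
Hypothesis rhoE : rho = (64 * d%:R ^+ 2)^-1.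
Local Notation T := ('I_n + 'I_n)%type.
Local Notation G := ('I_n + 'I_d + 'I_n)%type.
Local Notation vec := (state_vec P (fun l => hat (c l))).
Local Notation mass := (linform (@mass_coef R n _)).
Local Notation last := (rshift d (0 : 'I_1)).

Variables (p : {ffun 'I_n -> 'I_m}) (s : T -> R) (b : {ffun 'I_(d + 1) -> G}).
Hypothesis maximal : maximal_config P c rho p s b.

Let H := row_mx_of P c rho p s b.
Let Psi r := col r (invmx H).

Ltac goal_lra := clear - d_ge2 n_eq hull rhoE maximal H Psi; lra.
Ltac goal_nra := clear - d_ge2 n_eq hull rhoE maximal H Psi; nra.
Local Notation colours := (colours b).

Lemma d_gt0R : 0 < d%:R :> R. Proof. by rewrite ltr0n ltnW. Qed.
Lemma d_ge2R : 2 <= d%:R :> R. Proof. by rewrite (ler_nat R 2). Qed.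
Lemma rho_gt0 : 0 < rho.
Proof. by rewrite rhoE invr_gt0 mulr_gt0 // exprn_gt0 // d_gt0R. Qed.

Lemma reserve_eps_bounds (eps := rho / (42 * d%:R ^+ 2)) :
  0 < eps /\ d%:R * eps <= 10000^-1.
Proof.
have d0 := d_gt0R; have d2 := d_ge2R; have r0 := rho_gt0.
have d2_gt0 : 0 < d%:R ^+ 2 :> R by exact: exprn_gt0.
split; first by rewrite divr_gt0 // mulr_gt0.
have -> : d%:R * eps = rho / 42 / d%:R by rewrite /eps; field; lra.
have d4 : 4 <= d%:R ^+ 2 :> R by rewrite expr2; nra.
have dd : 0 < 64 * d%:R ^+ 2 :> R by lra.
have : rho <= 256^-1 by rewrite rhoE lef_pV2 ?posrE //; lra.
by rewrite ler_pdivrMr //; lra.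
Qed.

Lemma colour_of_row r : r != last -> exists i, b r = inl (inl i).
Proof.
rewrite -(centre_last maximal); case E : (b r) => [[i|k]|l] // _; first by exists i.
by have /eqP := eye_row_absurd d_ge2 n_eq hull rho_gt0 maximal r k rhoE.
Qed.

Lemma centre_of_last : exists l, b last = inr l.
Proof.
by have := centre_last maximal last; rewrite eqxx; case: (b last) => // l _; exists l.
Qed.

Lemma row_inj r r' : b r = b r' -> r = r'.
Proof.
move=> rr'; have e1 := Psi_row maximal r' r'; have e2 := Psi_row maximal r' r.
have rows : row r H = row r' H by rewrite !row_row_mx_of rr'.
by move: e2; rewrite rows e1 eqxx; case: eqP => // _ /eqP; rewrite oner_eq0.
Qed.

Lemma maximal_mass : mass s = 1. Proof. by case: maximal => -[]. Qed.
Lemma maximal_balance : lincomb (vec p) s = 0. Proof. by case: maximal => -[]. Qed.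
Lemma maximal_le1 t : s t <= 1.
Proof. by case: maximal => /config_le1/(_ t)/andP[]. Qed.

(** Distinct rows carry distinct colours, and the colour weights total 1. *)
Lemma row_weight_sum : \sum_(r | r != last) row_weight rho s (b r) <= 1.
Proof.
have n0 : (0 < n)%N by move: n_eq d_ge2; clear; lia.
pose f r := if b r is inl (inl i) then i else Ordinal n0.
have fE r : r != last -> b r = inl (inl (f r)).
  by move=> /colour_of_row[i bi]; rewrite /f bi.
rewrite (eq_bigr (fun r => s (inl (f r)))) => [|r /fE -> //].
rewrite -(big_imset (fun i => s (inl i)) (A := predC1 last)) /=; last first.
  by move=> r r' rl r'l ff; apply: row_inj; rewrite !fE // ff.
rewrite -maximal_mass -(mass_balance maximal_balance) [leRHS](bigID (mem (f @: predC1 last))) /=.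
by rewrite lerDl sumr_ge0 // => i _; exact: (maximal_ge0 maximal).
Qed.

(* Cramer's rule for the matrix whose centre row is a heavy centre [l'],
   read off on the last coordinate, where [ehat k] vanishes. *)
Lemma last_functional_bound k :
  `|pairing (ehat R k) (Psi last)| <= 2 * d%:R / rho.
Proof.
have n0 : (0 < n)%N by move: n_eq d_ge2; clear; lia.
have [l' sl'] : exists l', 1 / n%:R <= s (inr l').
  by apply: exists_large_term => //; rewrite -mass_sum maximal_mass.
have nR : n%:R = 2 * d%:R :> R by rewrite n_eq natrM.
rewrite div1r nR in sl'.
pose b1 := replace_row b last (inr l').
have cb1 : row_choice b1 by apply: (replace_row_choice maximal); rewrite eqxx.
pose A := row_mx_of P c rho p s b1.
pose z := rho *: ehat R k.
(* The adjugate replaces the inverse because [A] may be singular. *)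
have zA r : (z *m \adj A) 0 r =
    \det (\matrix_r' (if r' == r then z else row r' A)).
  rewrite (@det_replace_adj _ _ A _ r) => [|r' /negbTE r'r]; rewrite rowK ?eqxx //.
  by rewrite r'r.
have zAA : (z *m \adj A *m A) 0 last = 0.
  rewrite -mulmxA mul_adj_mx mul_mx_scalar /z mxE [X in _ * X]mxE ehat_last.
  by rewrite !mulr0.
have Alast r : A r last = row_weight rho s (b1 r).
  rewrite mxE; have : row_dir P c p (b1 r) 0 last = 1.
    rewrite ffunE; case: eqP => [_|/eqP /colour_of_row[i ->]] /=; exact: hat_last.
  by move=> e; rewrite mxE e mulr1.
have H0 := detH_neq0 maximal.
have Hn0 : 0 < `|\det H| by rewrite normr_gt0.
have zlast : (z *m \adj A) 0 last = pairing z (Psi last) * \det H.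
  rewrite zA; rewrite (@det_replace_row _ _ H _ last H0) => [|r' /negbTE r'r].
    by rewrite rowK eqxx.
  by rewrite rowK r'r !row_row_mx_of ffunE r'r.
have zr r : r != last -> `|(z *m \adj A) 0 r| <= `|\det H|.
  move=> rl; rewrite zA.
  have -> : \matrix_r' (if r' == r then z else row r' A) =
      row_mx_of P c rho p s (replace_row b1 r (inl (inr k))).
    apply/row_matrixP => r'; rewrite rowK [RHS]row_row_mx_of.
    have -> : replace_row b1 r (inl (inr k)) r' = if r' == r then inl (inr k) else b1 r'.
      by rewrite ffunE.
    by case: eqP => //; rewrite row_row_mx_of.
  case: (maximal) => cs _ _; apply => //; apply/forallP => r'; rewrite ffunE.
  have [->|_] := eqVneq r' r; first by rewrite /= (negbTE rl).
  exact: (forallP cb1).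
move: zAA; rewrite mxE (bigD1 last) //= zlast Alast ffunE eqxx /=.
move/eqP; rewrite addr_eq0 => /eqP/(congr1 Num.norm); rewrite normrN !normrM => zsum.
have : `|pairing z (Psi last)| * `|\det H| * `|s (inr l')| <= `|\det H|.
  rewrite zsum; apply: le_trans (ler_norm_sum _ _ _) _.
  apply: (@le_trans _ _ (\sum_(r | r != last) `|\det H| * row_weight rho s (b r))).
    apply: ler_sum => r rl; rewrite Alast ffunE (negbTE rl) normrM.
    rewrite (ger0_norm (ltW (weight_gt0 rho_gt0 maximal r))).
    by rewrite ler_wpM2r ?zr // ltW // (weight_gt0 rho_gt0 maximal).
  rewrite -mulr_sumr -[leRHS]mulr1 ler_wpM2l //; exact: row_weight_sum.
rewrite mulrAC -[leRHS]mul1r ler_pM2r // (ger0_norm (maximal_ge0 maximal _)).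
rewrite pairingZ normrM (gtr0_norm rho_gt0) => le1.
have h0 := normr_ge0 (pairing (ehat R k) (Psi last)).
rewrite ler_pdivlMr ?rho_gt0 //.
have d0 := d_gt0R; have r0 := rho_gt0.
have : rho * `|pairing (ehat R k) (Psi last)| * (2 * d%:R)^-1 <= 1.
  by apply: le_trans le1; rewrite ler_wpM2l // mulr_ge0 // ltW.
by rewrite ler_pdivrMr ?mulr_gt0 // mul1r mulrC.
Qed.

(** If all values vanished, [Psi last] would be constant on lifted points, yet it is 0 at the point
    of a colour row and nonzero at the centre of the last row. *)
Lemma exists_max_coord : exists k0,
  (forall k, `|pairing (ehat R k) (Psi last)| <= `|pairing (ehat R k0) (Psi last)|)
  /\ 0 < `|pairing (ehat R k0) (Psi last)|.
Proof.
pose k1 : 'I_d := Ordinal (ltnW d_ge2).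
case: (@arg_maxP _ R 'I_d k1 predT (fun k => `|pairing (ehat R k) (Psi last)|)) => // k0 _ kmax.
exists k0; split => [k|]; first exact: kmax.
rewrite lt_neqAle normr_ge0 andbT eq_sym; apply/negP => /eqP h0.
have hk k : pairing (ehat R k) (Psi last) = 0.
  by apply/eqP; rewrite -normr_le0 -h0; exact: kmax.
have same (x y : 'rV[R]_d) : pairing (hat x) (Psi last) = pairing (hat y) (Psi last).
  apply/eqP; rewrite -subr_eq0 -pairingN -pairingD hat_sub pairing_sum big1 // => k _.
  by rewrite pairingZ hk mulr0.
have rl : lshift 1 k1 != last by rewrite eq_lrshift.
have [i bi] := colour_of_row rl.
have [l bl] := centre_of_last.
have := Psi_row maximal last (lshift 1 k1); have := Psi_row maximal last last.
rewrite eqxx (negbTE rl) !row_row_mx_of bi bl /= !pairingZ => e1 /eqP.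
have := weight_gt0 rho_gt0 maximal (lshift 1 k1); rewrite bi /= => si.
rewrite mulf_eq0 (gt_eqF si) /= (same _ (c l)) => /eqP e0.
by move: e1; rewrite e0 mulr0 => /eqP; rewrite eq_sym oner_eq0.
Qed.

(** [Psi last] is 1 on the centre row, and the normalising factor is at most [2 d / rho]. *)
Lemma centre_pairing l k0 : b last = inr l ->
  0 < `|pairing (ehat R k0) (Psi last)| ->
  rho / (2 * d%:R) <=
  s (inr l) * pairing (hat (c l)) (`|pairing (ehat R k0) (Psi last)|^-1 *: Psi last).
Proof.
move=> bl h0; have := Psi_row maximal last last.
rewrite eqxx row_row_mx_of bl /= pairingZ pairingZr mulrCA => ->.
rewrite mulr1 -[leLHS]invrK lef_pV2 ?posrE ?invr_gt0 //; last first.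
  by rewrite divr_gt0 ?mulr_gt0 ?rho_gt0 ?d_gt0R.
by rewrite invfM invrK mulrC; exact: last_functional_bound.
Qed.

(* Pigeonhole over [2 d + 1] values of the reserve: a centre can be balanced
   by [c l] on the hyperplane for at most one of them. *)
Lemma reserve_exists l th : 0 < s (inr l) ->
  rho / (2 * d%:R) <= s (inr l) * pairing (hat (c l)) th ->
  exists sg, [/\ s (inr l) / 2 <= sg, sg <= 9 / 10 * s (inr l) & forall l',
    2 * (rho / (42 * d%:R ^+ 2)) <
      `|pairing (sg *: hat (c l) + (1 - sg) *: hat (c l')) th|].
Proof.
move=> sl; set q := pairing (hat (c l)) th => vq; set e := rho / (42 * d%:R ^+ 2).
(* Candidate ratios [sg / s (inr l)], spread over [[1/2, 9/10]] with spacing [1 / (5 d)]. *)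
pose tau (i : 'I_(2 * d).+1) : R := 2^-1 + i%:R / (5 * d%:R).
have d0 := d_gt0R; have r0 := rho_gt0.
have e0 : 0 < e by rewrite divr_gt0 // mulr_gt0 // exprn_gt0.
(* The 42 in [e] is chosen for this 21: two candidates sharing a bad centre would give
   [21/5 e <= 4 e]. *)
have ed : rho / (2 * d%:R) = 21 * (d%:R * e) by rewrite /e; field; lra.
have de : 2 * e <= d%:R * e by rewrite ler_wpM2r ?d_ge2R // ltW.
rewrite ed in vq.
have tau_ge i : 2^-1 <= tau i by rewrite lerDl divr_ge0 // mulr_ge0 // ltW.
have tau_le i : tau i <= 9 / 10.
  rewrite /tau; suff : i%:R / (5 * d%:R) <= 2 / 5 :> R by lra.
  rewrite ler_pdivrMr ?mulr_gt0 //.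
  have : i%:R <= (2 * d)%:R :> R by rewrite ler_nat -ltnS.
  by rewrite natrM; lra.
apply: contrapT => no.
have bad i : exists l', `|pairing ((tau i * s (inr l)) *: hat (c l) +
    (1 - tau i * s (inr l)) *: hat (c l')) th| <= 2 * e.
  apply: contrapT => nobad; apply: no; exists (tau i * s (inr l)); split.
  - by rewrite mulrC ler_wpM2r // ltW.
  - by rewrite ler_wpM2r // ltW.
  - by move=> l'; rewrite ltNge; apply/negP => le; apply: nobad; exists l'.
have [f fP] := choice bad.
have [i [i' [ii' fii']]] : exists i i' : 'I_(2 * d).+1, (i < i')%N /\ f i = f i'.
  apply: contrapT => inj.
  have finj : injective f.
    move=> i i' ff; apply/val_inj/eqP; rewrite eqn_leq.
    by apply/andP; split; rewrite leqNgt; apply/negP => lt;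
      apply: inj; [exists i', i|exists i, i'].
  by have := leq_card f finj; rewrite !card_ord n_eq ltnn.
have := fP i'; have := fP i; rewrite -fii' !pairingD !pairingZ -/q.
set x := pairing _ th; set v := s (inr l) in sl vq *.
have v1 : v <= 1 by exact: maximal_le1.
have ti := tau_ge i; have ti' := tau_ge i'; have ui := tau_le i; have ui' := tau_le i'.
have gap : (5 * d%:R)^-1 <= tau i' - tau i.
  rewrite /tau opprD addrACA subrr add0r -mulrBl -[leLHS]mul1r.
  apply: ler_wpM2r; first by rewrite invr_ge0 mulr_ge0 // ltW.
  by rewrite -natrB ?(ltnW ii') // (ler_nat R 1) subn_gt0.
rewrite !ler_norml => /andP[l1 u1] /andP[l2 u2].
have q0 : 0 < v * q.
  apply: lt_le_trans vq; apply: mulr_gt0 => //; exact: mulr_gt0.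
have Q0 : 0 < q by rewrite -(pmulr_rgt0 _ sl).
have vt : 2^-1 * (v * q) <= tau i * v * q by rewrite -mulrA ler_wpM2r // ltW.
have tv1 : tau i * v <= 9 / 10.
  by apply: le_trans ui; rewrite ger_pMr //; lra.
(* The share on [c l] alone exceeds [2 e], so [c l'] lies on the other side of the hyperplane. *)
have x0 : x < 0.
  rewrite ltNge; apply/negP => x0.
  have : 0 <= (1 - tau i * v) * x by apply: mulr_ge0 => //; lra.
  lra.
have : (tau i' - tau i) * (v * (q - x)) <= 4 * e by lra.
apply/negP; rewrite -ltNge.
have vqx : v * q <= v * (q - x) by rewrite ler_pM2l //; lra.
apply: (@lt_le_trans _ _ ((5 * d%:R)^-1 * (v * q))).
  rewrite ltr_pdivlMl ?mulr_gt0 //; apply: lt_le_trans vq.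
  have : 0 < d%:R * e by rewrite mulr_gt0.
  by lra.
by rewrite ler_pM ?invr_ge0 ?(ltW q0) // mulr_ge0 // ltW.
Qed.

(** With [d] colours frozen the ascent needs two active centres. A lone mixed centre is more than
    [2 eps] off the hyperplane and has mass above 1/2, which gain at most [eps] cannot balance; a
    lone pure centre is too expensive. *)
Lemma reserve_ascent l k0 (th := `|pairing (ehat R k0) (Psi last)|^-1 *: Psi last)
    (eps := rho / (42 * d%:R ^+ 2)) (f := (1 + 16 * eps)^-1) :
  b last = inr l -> 0 < `|pairing (ehat R k0) (Psi last)| ->
  exists p' s' j, [/\ is_config P c p' s', forall i, i \in colours -> p' i = p i,
    j \notin colours, forall i, i \in colours -> f * s (inl i) <= s' (inl i) &
    s (inr l) / 3 <= s' (inr l) /\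
    f * (eps / n%:R) <= s' (inl j) * `|pairing (hat (P j (p' j))) th|].
Proof.
move=> bl h0.
have d0 := d_gt0R; have r0 := rho_gt0; have d2 := d_ge2R.
have sl : 0 < s (inr l) by have := weight_gt0 rho_gt0 maximal last; rewrite bl.
have [sg [sg_ge sg_le sgP]] := reserve_exists sl (centre_pairing bl h0).
rewrite -/th -/eps in sgP.
have sl1 := maximal_le1 (inr l).
have [eps0 deps] : 0 < eps /\ d%:R * eps <= 10000^-1 := reserve_eps_bounds.
have eps_small : eps <= 10000^-1.
  apply: le_trans deps; rewrite -[leLHS]mul1r ler_wpM2r ?(ltW eps0) //.
  by rewrite (ler_nat R 1) ltnW.
have sg1 : 0 < 1 - sg by move: sg_le sl1; goal_lra.
have sg0 : 0 <= sg by move: sg_ge sl; goal_lra.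
have sg01 : 0 <= sg <= 1 by rewrite sg0 -subr_ge0 ltW.
have frozen0 t : 0 <= frozen s b l 0 t.
  by case: t => i /=; case: ifP => // _; exact: (maximal_ge0 maximal).
have mass_frozen : mass (frozen s b l 0) = 0.
  by rewrite mass_sum big1 // => l' _ /=; case: ifP.
pose F := lincomb (vec p) (frozen s b l 0).
pose kap (u : 'I_n + 'I_n) : R := if u is inl _ then 16^-1 else 2^-1.
(* The centres of [s] rewritten as mixed ones: [sg] is taken off [c l] and the rest rescaled to
   total 1. *)
pose s0 (t : 'I_n + ('I_n + 'I_n)) : R := match t with
  | inl i => if i \in colours then 0 else s (inl i)
  | inr (inl l') => (s (inr l') - (if l' == l then sg else 0)) / (1 - sg)
  | inr (inr _) => 0 end.
have sum_sg : \sum_k s0 (inr (inl k)) = 1.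
  rewrite /= -mulr_suml sumrB -mass_sum maximal_mass (bigD1 l) //= eqxx big1 ?addr0.
    by rewrite divff // gt_eqF.
  by move=> k /negbTE ->.
have merge0 t : merge_centres l sg s0 t + 1 * frozen s b l 0 t = s t.
  case: t => [i|l'].
    by rewrite /=; case: ifP => _; rewrite mul1r ?add0r ?addr0.
  rewrite /merge_centres sum_sg /= addr0 mulrCA divff ?mulr1; last by rewrite gt_eqF.
  by case: eqP => _; rewrite ?subrK ?mulr0 ?addr0 ?subr0.
have err0 : state_err P (mixed_centre c l sg) F p s0 = 0.
  rewrite /state_err -merge_centres_vec addrC -[F]scale1r -lincombD.
  by rewrite -[RHS]maximal_balance; congr lincomb; apply/funext.
pose Mof s2 := linform (@mass_coef R n ('I_n + 'I_n)%type) s2.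
have total (p' : {ffun 'I_n -> 'I_m}) s2 : (forall i, i \in colours -> p' i = p i) ->
    (forall t, 0 <= s2 t) -> state_err P (mixed_centre c l sg) F p' s2 = 0 -> 0 < Mof s2 ->
    is_config P c p' (fun t => (Mof s2)^-1 *
      (merge_centres l sg s2 t + 1 * frozen s b l 0 t)).
  move=> pA s20 s2E M0.
  have massE : mass (fun t => merge_centres l sg s2 t + 1 * frozen s b l 0 t) = Mof s2.
    by rewrite linformD mass_frozen mulr0 addr0 merge_centres_mass.
  rewrite -massE; apply: config_normalise.
  - by move=> t; rewrite mul1r addr_ge0 // merge_centres_ge0.
  - by rewrite lincombD (frozen_vec P c s l 0 pA) scale1r merge_centres_vec addrC.
  - by rewrite massE.
have masses s2 : (forall t, 0 <= s2 t) ->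
    linform (cost_coef kap) s2 <= linform (cost_coef kap) s0 + eps -> 2^-1 <= Mof s2 ->
    [/\ Mof s2 <= 1 + 16 * eps, \sum_k s2 (inr (inr k)) <= 2^-1 * 3^-1 &
      Mof s2 * 2 / 3 <= \sum_k s2 (inr (inl k))].
  move=> s20; rewrite !cost_two sum_sg /Mof mass_two.
  have -> : \sum_k s0 (inr (inr k)) = 0 by rewrite big1.
  by apply: two_masses_bound => //; exact: sumr_ge0.
have half_lt1 : 2^-1 < 1 :> R by rewrite invf_lt1 // ltr1n.
have kap0 u : 0 < kap u by case: u => k; rewrite /kap invr_gt0.
have ent j : exists2 u, mixed_centre c l sg u = hat (c j) & kap u < 1.
  by exists (inr j).
have centre_weight s2 : (forall t, 0 <= s2 t) -> 0 < Mof s2 ->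
    Mof s2 * 2 / 3 <= \sum_k s2 (inr (inl k)) ->
    s (inr l) / 3 <= (Mof s2)^-1 * (merge_centres l sg s2 (inr l) + 1 * frozen s b l 0 (inr l)).
  move=> s20 M0 Ma; rewrite ler_pdivlMl //= eqxx mulr0 addr0.
  have : s (inr l) / 2 * (Mof s2 * 2 / 3) <= sg * \sum_k s2 (inr (inl k)).
    by apply: ler_pM => //; rewrite ?divr_ge0 ?mulr_ge0 // ltW.
  have : 0 <= (1 - sg) * s2 (inr (inl l)) by rewrite mulr_ge0 // ltW.
  by have := s20 (inr (inr l)); goal_lra.
have colour_weight s2 i : (forall t, 0 <= s2 t) -> 0 < Mof s2 -> i \in colours ->
    (Mof s2)^-1 * s (inl i) <=
    (Mof s2)^-1 * (merge_centres l sg s2 (inl i) + 1 * frozen s b l 0 (inl i)).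
  by move=> s20 M0 iA; rewrite ler_pM2l ?invr_gt0 //= iA mul1r lerDr.
have th_colour i : i \in colours -> pairing (hat (P i (p i))) th = 0.
  move=> iA; rewrite /th pairingZr (colour_functional0 rho_gt0 maximal iA) ?mulr0 //.
  by move=> r' br'; rewrite -(centre_last maximal) br'.
have cA : (#|colours| <= d)%N.
  have : (#|colours| <= #|~: [set last]%SET|)%N.
    apply: colours_card => r i br.
    by rewrite !inE -(centre_last maximal) br.
  by rewrite cardsC1 card_ord addn1.
have [||||||p' [s2 [pA s20 s2E s2c [s2N s2g]]]] :=
  @ascent R d n m ('I_n + 'I_n)%type P c (mixed_centre c l sg)
  kap F th k0 colours p 2^-1 eps _ hull kap0 ent _ eps0 s0.
- by rewrite n_eq mul2n addnn.
- by rewrite /th pairingZr normrM normrV ?unitfE ?gt_eqF // normr_id mulVf // gt_eqF.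
- case=> [i|[l'|l']] //=; first by case: ifP => // _; exact: (maximal_ge0 maximal).
  rewrite divr_ge0 ?(ltW sg1) //; case: eqP => [->|_].
    by move: sg_le sl; goal_lra.
  by rewrite subr0 (maximal_ge0 maximal).
- exact: err0.
- by rewrite mass_two sum_sg big1 // addr0 ltW.
- move=> p' s2 pA s20 s2E s2c s2N s2g.
  have M0 : 0 < Mof s2 by apply: lt_le_trans s2N; rewrite invr_gt0.
  have [M1 Mb Ma] := masses s2 s20 s2c s2N.
  have cs' := total _ _ pA s20 s2E M0.
  (* Otherwise normalising at least doubles all [d] colour rows while the centre row keeps a third,
     and [2 ^ d / 3 > 1]. *)
  have Mhalf : 2^-1 < Mof s2.
    rewrite ltNge; apply/negP => Mle.
    have Minv : 2 <= (Mof s2)^-1 by rewrite -[2]invrK lef_pV2 ?posrE.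
    pose r : 'I_(d + 1) := lshift 1 (Ordinal (ltnW d_ge2)).
    have rl : r != last by rewrite eq_lrshift.
    have [i br] := colour_of_row rl.
    have iA : i \in colours by rewrite inE; apply/existsP; exists r; rewrite br.
    have si : 0 < s (inl i) by have := weight_gt0 rho_gt0 maximal r; rewrite br.
    pose ar := (Mof s2)^-1 * (merge_centres l sg s2 (inl i) + 1 * frozen s b l 0 (inl i))
      / s (inl i).
    have ar2 : 2 <= ar.
      rewrite /ar ler_pdivlMr //; apply: le_trans (colour_weight _ _ s20 M0 iA).
      by rewrite ler_wpM2r // ltW.
    have t3 : 0 <= 3^-1 :> R by rewrite invr_ge0.
    have ar0 : 0 <= ar by exact: le_trans (ler0n _ 2) ar2.
    have := scaled_exchange d_ge2 rho_gt0 maximal (g := inl (inl i)) (z := row r H) (f := 2)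
      (fl := 3^-1) (ar := ar) cs' pA rl erefl (ler0n _ 2) t3 ar0.
    rewrite (Psi_row maximal) eqxx normr1 mulr1 => ex.
    have {}ex : 3^-1 * (2 ^+ d.-1 * ar) <= 1.
      apply: ex => [k kr kl||].
      - have [j bk] := colour_of_row kl; rewrite bk.
        have jA : j \in colours by rewrite inE; apply/existsP; exists k; rewrite bk.
        apply: le_trans (colour_weight _ _ s20 M0 jA).
        by rewrite ler_wpM2r // (maximal_ge0 maximal).
      - by rewrite bl [X in _ * X]/= mulrC; exact: centre_weight.
      - by rewrite row_row_mx_of br /= pA // scalerA /ar divfK // gt_eqF.
    have : 2 * 2 <= 2 ^+ d.-1 * ar.
      apply: ler_pM => //; rewrite -[leLHS]expr1; apply: ler_weXn2l; first by rewrite ler1n.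
      by move: d_ge2; clear; lia.
    by move: ex; goal_lra.
  split => //; rewrite ltnNge; apply/negP => small.
  have [u su] : exists u, s2 (inr u) != 0.
    apply: contrapT => no; have : Mof s2 = 0.
      rewrite /Mof mass_two !big1 ?addr0 // => k _; apply/eqP; rewrite -[_ == _]negbK;
      by apply/negP => nz; apply: no; eexists; exact: nz.
    by move=> M00; rewrite M00 ltxx in M0.
  have su0 u' : u' != u -> s2 (inr u') = 0.
    move=> u'u; apply/eqP; rewrite -[_ == _]negbK; apply/negP => su'.
    have : (#|[set u; u']%SET| <= #|[set u | s2 (inr u) != 0%R]%SET|)%N.
      apply: subset_leq_card; apply/fintype.subsetP => x.
      by rewrite !inE => /orP[]/eqP ->.
    by rewrite cards2 eq_sym u'u; move: small cA; clear; lia.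
  move: Ma Mb M0 Mhalf; case: u su su0 => l' su su0.
    move=> _ _ M0 Mhalf.
    have ME : Mof s2 = s2 (inr (inl l')).
      rewrite /Mof mass_two (bigD1 l') //= big1 => [|k kl]; last exact: su0.
      by rewrite addr0 big1 ?addr0 // => k _; exact: su0.
    have : s2 (inr (inl l')) * pairing (sg *: hat (c l) + (1 - sg) *: hat (c l')) th =
        \sum_i s2 (inl i) * pairing (hat (P i (p' i))) th.
      have := congr1 (fun z => pairing z th) s2E; rewrite /state_err pairingD pairing0.
      rewrite {1}/F !pairing_lincomb {1}/linform big1 ?add0r; last first.
        move=> [i|k] _ /=; last by case: eqP; rewrite mul0r.
        by case: ifP => [/th_colour ->|]; rewrite ?mulr0 ?mul0r.
      have only : \sum_u s2 (inr u) * pairing (- mixed_centre c l sg u) th =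
          - (s2 (inr (inl l')) * pairing (mixed_centre c l sg (inl l')) th).
        rewrite (bigD1 (inl l')) //= big1 ?addr0 => [|k kl]; last by rewrite su0 // mul0r.
        by rewrite pairingN mulrN.
      rewrite /linform big_sumType /= only => /eqP; rewrite subr_eq0 => /eqP.
      by move=> ->.
    move=> /(congr1 Num.norm); rewrite normrM ger0_norm // -ME => e1.
    have : \sum_i s2 (inl i) * `|pairing (hat (P i (p' i))) th| <= eps.
      move: s2g; rewrite /linform big_sumType /= [X in _ + X]big1 ?addr0 // => k _.
      by rewrite mulr0.
    have x2 := sgP l'; move: x2 e1.
    set x := `|pairing (_ + _) th| => x2 e1.
    apply/negP; rewrite -ltNge; apply: (@lt_le_trans _ _ (Mof s2 * x)).
      have x0 : 0 <= x by exact: normr_ge0.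
      by have := ler_wpM2r x0 (ltW Mhalf); move: x2; goal_lra.
    rewrite e1; apply: le_trans (ler_norm_sum _ _ _) _.
    by apply: ler_sum => i _; rewrite normrM ger0_norm.
  move=> Ma Mb M0 Mhalf; move: Ma; rewrite big1 => [|k _]; last exact: su0.
  by move: M0; goal_lra.
have M0 : 0 < Mof s2 by apply: lt_le_trans s2N; rewrite invr_gt0.
have [M1 Mb Ma] := masses s2 s20 s2c s2N.
have cs' := total _ _ pA s20 s2E M0.
have n_gt0 : (0 < n)%N by move: n_eq d_ge2; clear; lia.
have gainE : linform (gain_coef P th p') s2 =
    \sum_i s2 (inl i) * `|pairing (hat (P i (p' i))) th|.
  by rewrite /linform big_sumType /= [X in _ + X]big1 ?addr0 // => l' _; rewrite mulr0.
rewrite gainE in s2g.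
have [j gj] := exists_large_term n_gt0 s2g.
have jA : j \notin colours.
  apply/negP => jA; move: gj; rewrite pA // th_colour // normr0 mulr0 leNgt divr_gt0 //.
  by rewrite ltr0n.
have Mbar0 : 0 < 1 + 16 * eps by move: eps0; goal_lra.
have fM : f <= (Mof s2)^-1 by rewrite lef_pV2 ?posrE.
exists p', (fun t => (Mof s2)^-1 * (merge_centres l sg s2 t + 1 * frozen s b l 0 t)), j.
split => //.
- move=> i iA; apply: le_trans (colour_weight _ _ s20 M0 iA).
  by rewrite ler_wpM2r // (maximal_ge0 maximal).
- split; first exact: centre_weight.
  have e0 : 0 <= eps / n%:R by rewrite divr_ge0 // ltW.
  apply: (@le_trans _ _ ((Mof s2)^-1 * (eps / n%:R))); first exact: ler_wpM2r.
  rewrite /= (negbTE jA) mulr0 addr0 -[leRHS]mulrA ler_wpM2l // invr_ge0 ltW //.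
Qed.

End ColourRows.

(** * Basis directions as bounded combinations of weighted colours *)

Section Spanning.
Variables (R : realType) (d n m : nat).
Variables (P : 'I_n -> 'I_m -> 'rV[R]_d) (c : 'I_n -> 'rV[R]_d) (rho : R).
Hypothesis d_ge2 : (2 <= d)%N.
Hypothesis n_eq : n = (2 * d)%N.
Hypothesis hull : forall i k, conv_hull (range (P i)) (c i + delta_mx 0 k) /\
  conv_hull (range (P i)) (c i - delta_mx 0 k).
Hypothesis rhoE : rho = (64 * d%:R ^+ 2)^-1.
Local Notation T := ('I_n + 'I_n)%type.
Local Notation last := (rshift d (0 : 'I_1)).

Ltac goal_lra := clear - d_ge2 n_eq hull rhoE; lra.
Ltac goal_nra := clear - d_ge2 n_eq hull rhoE; nra.

(** 101/100 bounds [f^-1]; [rho^-1] and 4 bound the coordinates of [ehat R k] and of the new colour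
    along the colour rows; the inner product bounds the coefficient of the new colour. *)
Definition coef_bound : R :=
  101 / 100 * (rho^-1 + 4 * (101 / 100 * (2 * d%:R / (rho / (42 * d%:R ^+ 2))))).

(** The new colour [j] has a [Psi last] coordinate bounded away from 0, so a multiple of it cancels
    the centre row in the expansion of [ehat R k]. *)
Lemma spanning_configuration (p0 : {ffun 'I_n -> 'I_m}) :
  exists (p' : {ffun 'I_n -> 'I_m}) (s' : T -> R), is_config P c p' s' /\
    forall k, exists t : 'I_n -> R, (forall i, `|t i| <= coef_bound) /\
      \sum_i (t i * s' (inl i)) *: hat (P i (p' i)) = ehat R k.
Proof.
have r0 : 0 < rho by exact: rho_gt0 rhoE.
have d0 : 0 < d%:R :> R by exact: d_gt0R.
have d2 : 2 <= d%:R :> R by exact: d_ge2R.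
have [p [s [b maximal]]] := maximal_config_exists d_ge2 n_eq hull r0 p0.
pose H := row_mx_of P c rho p s b; pose Psi r := col r (invmx H).
have [l bl] := centre_of_last maximal.
have [k0 [kmax h0]] := exists_max_coord d_ge2 n_eq hull rhoE maximal.
have [p' [s' [j [cs' pA jA sA [sL sj]]]]] :=
  reserve_ascent d_ge2 n_eq hull rhoE maximal bl h0.
exists p', s'; split => // k.
move: sA sL sj kmax h0; rewrite -/H -/(Psi _).
set g0 := `|pairing (ehat R k0) (Psi last)|; set eps := rho / (42 * d%:R ^+ 2).
set f := (1 + 16 * eps)^-1 => sA sL sj kmax g0_gt0.
have [eps0 deps] : 0 < eps /\ d%:R * eps <= 10000^-1.
  exact: (reserve_eps_bounds d_ge2 rhoE).
have eps_le : 2 * eps <= d%:R * eps by rewrite ler_wpM2r // ltW.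
have Mbar0 : 0 < 1 + 16 * eps by move: eps0; goal_lra.
have f0 : 0 < f by rewrite invr_gt0.
have fV : f^-1 <= 101 / 100 by rewrite invrK; move: deps eps_le; goal_lra.
have fle : 1 - 16 * eps <= f.
  by rewrite /f -[leRHS]mul1r ler_pdivlMr //; goal_nra.
have f1 : f <= 1 by rewrite invf_le1 //; move: eps0; goal_lra.
have fd : 3 / 4 <= f ^+ d.-1.
  have e01 : 0 <= 16 * eps <= 1 by apply/andP; split; move: eps0 eps_le deps; goal_lra.
  apply: (@le_trans _ _ (f ^+ d)); last by rewrite ler_wiXn2l ?(ltW f0) // leq_pred.
  apply: le_trans (le_trans (bernoulli_le d e01) _).
    have -> : d%:R * (16 * eps) = 16 * (d%:R * eps) by ring.
    by move: deps; goal_lra.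
  apply: lerXn2r => //; rewrite nnegrE ?(ltW f0) //.
  by move: eps_le deps; goal_lra.
pose Y := s' (inl j) *: hat (P j (p' j)).
pose y r := pairing Y (Psi r).
pose e r := pairing (ehat R k) (Psi r).
have colour_row r : r != last -> exists i, b r = inl (inl i).
  exact: (colour_of_row d_ge2 n_eq hull rhoE maximal).
have inA r i : b r = inl (inl i) -> i \in colours b.
  by move=> br; rewrite inE; apply/existsP; exists r; rewrite br.
have y_le r : r != last -> `|y r| <= 4.
  move=> rl; have t3 : 0 <= 3^-1 :> R by rewrite invr_ge0.
  have := scaled_exchange d_ge2 r0 maximal (g := inl (inl j)) (z := Y) (f := f)
    (fl := 3^-1) (ar := 1) cs' pA rl erefl (ltW f0) t3 ler01.
  rewrite -/H -/(Psi r) -/(y r) mul1r => ex.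
  have {}ex : 3^-1 * (f ^+ d.-1 * `|y r|) <= 1.
    apply: ex => [k' kr kl||].
    - by have [i bk] := colour_row k' kl; rewrite bk; apply: sA; exact: inA bk.
    - by rewrite bl mulrC.
    - by rewrite scale1r.
  have : 3 / 4 * `|y r| <= f ^+ d.-1 * `|y r| by rewrite ler_wpM2r.
  by move: ex; goal_lra.
have e_le r : r != last -> `|e r| <= rho^-1.
  move=> rl; have := single_exchange maximal (r := r) (g := inl (inr k)).
  rewrite (negbTE rl) => /(_ erefl); rewrite pairingZ normrM gtr0_norm //= => e1.
  by rewrite -[leRHS]mulr1 ler_pdivlMl.
have y_last : g0 * (f * (eps / n%:R)) <= `|y last|.
  have -> : `|y last| = g0 * (s' (inl j) * `|pairing (hat (P j (p' j))) (g0^-1 *: Psi last)|).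
    rewrite /y pairingZ pairingZr !normrM mulrCA; congr (_ * _).
      by rewrite ger0_norm //; case: cs' => + _ _; apply.
    by rewrite normfV (gtr0_norm g0_gt0) mulrA mulfV ?mul1r // gt_eqF.
  by rewrite ler_wpM2l // ltW.
have nR : n%:R = 2 * d%:R :> R by rewrite n_eq natrM.
have n0R : 0 < n%:R :> R by rewrite nR mulr_gt0.
have feps0 : 0 < f * (eps / n%:R) by rewrite mulr_gt0 // divr_gt0.
have y_last0 : 0 < `|y last| by apply: lt_le_trans y_last; rewrite mulr_gt0.
pose q := e last / y last.
(* As [g0] is the maximum over all [k], it cancels from numerator and denominator. *)
have q_le : `|q| <= 101 / 100 * (2 * d%:R / eps).
  rewrite /q normrM normfV ler_pdivrMr //.
  apply: (@le_trans _ _ g0); first exact: kmax.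
  apply: (@le_trans _ _ (f^-1 * (2 * d%:R / eps) * (g0 * (f * (eps / n%:R))))).
    rewrite le_eqVlt; apply/orP; left; apply/eqP; rewrite nR; field.
    by rewrite !gt_eqF.
  apply: ler_pM => //.
  - by rewrite mulr_ge0 ?invr_ge0 ?divr_ge0 ?mulr_ge0 // ltW.
  - by rewrite mulr_ge0 // ltW.
  - by rewrite ler_wpM2r // divr_ge0 ?mulr_ge0 // ltW.
pose coef r := e r - q * y r.
have coef_le r : r != last -> `|coef r| <= rho^-1 + 4 * (101 / 100 * (2 * d%:R / eps)).
  move=> rl; apply: le_trans (ler_normB _ _) _; apply: lerD; first exact: e_le.
  by rewrite normrM mulrC; apply: ler_pM => //; exact: y_le.
have H0 := detH_neq0 maximal.
have decomp : ehat R k = \sum_(r | r != last) coef r *: row r H + q *: Y.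
  have := row_decomposition (ehat R k) H0; rewrite (bigD1 last) //= => eD.
  have := row_decomposition Y H0; rewrite (bigD1 last) //= => YD.
  rewrite [X in _ + q *: X]YD eD -/(Psi last) -/(e last) -/(y last) scalerDr scalerA.
  rewrite /q divfK -?normr_gt0 // addrCA; congr (_ + _).
  rewrite scaler_sumr -big_split; apply: eq_bigr => r _ /=.
  by rewrite scalerA -scalerDl /coef -/(Psi r) subrK.
(* The rows of [H] carry the weights [s]; the ratio converts them to [s']. *)
pose t i := \sum_(r | b r == inl (inl i)) coef r * (s (inl i) / s' (inl i)) + (i == j)%:R * q.
exists t; split.
- move=> i; rewrite /t; have [iA|iA] := boolP (i \in colours b).
    have /negbTE -> : i != j by apply: contraNneq jA => <-.
    rewrite mul0r addr0; move: (iA); rewrite inE => /existsP[r /eqP br].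
    rewrite (bigD1 r) ?br //= big1 ?addr0 => [|r' /andP[/eqP br' r'r]]; last first.
      by move/eqP: r'r; case; apply: (row_inj maximal); rewrite br' br.
    have rl : r != last by rewrite -(centre_last maximal) br.
    have si : 0 < s (inl i) by have := weight_gt0 r0 maximal r; rewrite br.
    have fs := sA i iA.
    have s'i : 0 < s' (inl i) by apply: lt_le_trans fs; rewrite mulr_gt0.
    rewrite normrM /coef_bound mulrC; apply: ler_pM => //; last exact: coef_le.
    have sr : 0 <= s (inl i) / s' (inl i) by apply: divr_ge0; exact: ltW.
    rewrite ger0_norm // ler_pdivrMr //.
    apply: le_trans (_ : f^-1 * s' (inl i) <= _); last by rewrite ler_wpM2r // ltW.
    by rewrite ler_pdivlMl.
  rewrite big1 ?add0r => [|r /eqP br]; last by rewrite (inA _ _ br) in iA.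
  have B0 : 0 <= 101 / 100 * (2 * d%:R / eps) by rewrite !mulr_ge0 ?invr_ge0 // ltW.
  have rV : 0 < rho^-1 by rewrite invr_gt0.
  rewrite /coef_bound -/eps; have [_|_] := eqVneq i j; last first.
    by rewrite mul0r normr0; move: B0 rV; goal_lra.
  by rewrite mul1r; move: q_le B0 rV; goal_lra.
- rewrite decomp /t.
  under eq_bigr do rewrite mulrDl scalerDl; rewrite big_split /=; congr (_ + _).
    under eq_bigr do rewrite mulr_suml scaler_suml.
    rewrite (exchange_big_dep (fun r => r != last)) /=; last first.
      by move=> i r _ /eqP br; rewrite -(centre_last maximal) br.
    apply: eq_bigr => r rl; have [i br] := colour_row r rl.
    rewrite (bigD1 i) ?br //= big1 ?addr0 => [|i' /andP[/eqP[->]]]; last first.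
      by rewrite eqxx.
    have iA := inA _ _ br.
    have si : 0 < s (inl i) by have := weight_gt0 r0 maximal r; rewrite br.
    have s'i : 0 < s' (inl i) by apply: lt_le_trans (sA i iA); rewrite mulr_gt0.
    rewrite row_row_mx_of br /= pA // -mulrA divfK ?gt_eqF // scalerA //.
  rewrite (bigD1 j) //= eqxx mul1r big1 ?addr0 => [|i /negbTE ->]; last first.
    by rewrite !mul0r scale0r.
  by rewrite /Y scalerA.
Qed.

End Spanning.

(** * Convex hulls and reduction to finite families *)

Section ConvexHull.
Variables (R : realType) (d : nat).
Implicit Types (X : set 'rV[R]_d).

Lemma conv_hull_convex X (x y : 'rV[R]_d) (l : R) : 0 <= l <= 1 ->
  conv_hull X x -> conv_hull X y -> conv_hull X (l *: x + (1 - l) *: y).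
Proof.
move=> l01 Xx Xy C [Ccvx XC].
have Cx := Xx C (conj Ccvx XC); have Cy := Xy C (conj Ccvx XC).
have l01' : Itv.spec (@Itv.num_sem R) (Itv.Real `[0%Z, 1%Z]) l.
  by rewrite /= /Itv.num_sem /= num_real in_itv /=.
have := Ccvx x y (Itv.mk l01'); rewrite !inE => /(_ Cx Cy).
exact.
Qed.

Lemma conv_hull_sub X Y : X `<=` Y -> conv_hull X `<=` conv_hull Y.
Proof. by move=> XY x Xx C [Ccvx YC]; apply: Xx; split=> // y /XY/YC. Qed.

Lemma conv_hull_combination (I : finType) (x : I -> 'rV[R]_d) (w : I -> R) :
  (forall i, 0 <= w i) -> \sum_i w i = 1 ->
  conv_hull (range x) (\sum_i w i *: x i).
Proof.
move=> w0 w1.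
(* The induction runs over normalised partial sums, hence the positivity condition. *)
suff hull_seq : forall r : seq I, 0 < \sum_(i <- r) w i ->
    conv_hull (range x) ((\sum_(i <- r) w i)^-1 *: \sum_(i <- r) w i *: x i).
  by have := hull_seq (index_enum I); rewrite w1 invr1 scale1r; apply.
elim=> [|i r IH]; first by rewrite big_nil ltxx.
rewrite !big_cons; set W := \sum_(j <- r) w j in IH *.
set S := \sum_(j <- r) w j *: x j in IH *.
have xi : conv_hull (range x) (x i) by apply: sub_gen_smallest; exists i.
have W0 : 0 <= W by exact: sumr_ge0.
have [Weq0|Wneq0] := eqVneq W 0.
  have -> : S = 0.
    rewrite /S big_seq big1 // => j jr; suff -> : w j = 0 by rewrite scale0r.
    apply/eqP; rewrite eq_le w0 andbT -Weq0 /W (big_rem j) //= lerDl.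
    exact: sumr_ge0.
  rewrite Weq0 !addr0 => wi; rewrite scalerA mulVf ?scale1r // gt_eqF //.
have Wgt0 : 0 < W by rewrite lt_neqAle eq_sym Wneq0.
move=> wW; have wWn : w i + W != 0 by rewrite gt_eqF.
have l01 : 0 <= w i / (w i + W) <= 1.
  by rewrite divr_ge0 ?(ltW wW) //= ler_pdivrMr // mul1r lerDl.
have -> : (w i + W)^-1 *: (w i *: x i + S) =
    (w i / (w i + W)) *: x i + (1 - w i / (w i + W)) *: (W^-1 *: S).
  rewrite scalerDr !scalerA; congr (_ *: _ + _ *: _); first by rewrite mulrC.
  by field; rewrite wWn Wneq0.
exact: (conv_hull_convex l01 xi (IH Wgt0)).
Qed.

(** Points lying in hulls of finite subsets form a convex set, by concatenating lists, and it
    contains [X]. *)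
Lemma conv_hull_finite X (x : 'rV[R]_d) : conv_hull X x ->
  exists2 s : seq 'rV[R]_d, (forall y, y \in s -> X y) &
    conv_hull [set y | y \in s] x.
Proof.
pose C := [set x : 'rV[R]_d | exists2 s : seq 'rV[R]_d, (forall y, y \in s -> X y) &
    conv_hull [set y | y \in s] x].
suff : conv_hull X `<=` C by apply.
apply: smallest_sub => [|y Xy].
  move=> y z l /set_mem[s sX sy] /set_mem[s' sX' sz]; apply/mem_set.
  exists (s ++ s').
    by move=> u; rewrite mem_cat => /orP[/sX|/sX'].
  have l01 : 0 <= l%:num <= 1 by rewrite ge0 le1.
  apply: (conv_hull_convex l01).
    by apply: conv_hull_sub sy => u /= us; rewrite mem_cat us.
  by apply: conv_hull_sub sz => u /= us; rewrite mem_cat us orbT.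
exists [:: y]; first by move=> u; rewrite inE => /eqP ->.
by apply: sub_gen_smallest => /=; rewrite inE.
Qed.

Lemma conv_hull_inhabited X (x : 'rV[R]_d) : conv_hull X x -> exists y, X y.
Proof.
move=> Xx; apply: contrapT => no.
have : (0 : R) <= -1; last by rewrite ler0N1.
apply: (@conv_hull_sublevel R d X (fun=> 0) (-1) _ _ x Xx) => [y z l _|y Xy].
  by rewrite !mulr0 addr0.
by case: no; exists y.
Qed.

Lemma conv_hull_finite_family X (I : finType) (x : I -> 'rV[R]_d) :
  (forall i, conv_hull X (x i)) ->
  exists2 s : seq 'rV[R]_d, (forall y, y \in s -> X y) &
    forall i, conv_hull [set y | y \in s] (x i).
Proof.
move=> Xx; have Xs i : exists s : seq 'rV[R]_d, (forall y, y \in s -> X y) /\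
    conv_hull [set y | y \in s] (x i).
  by have [s sX sx] := conv_hull_finite (Xx i); exists s.
have [f fP] := choice Xs.
exists (flatten [seq f i | i <- enum I]).
  by move=> y /flatten_mapP[i _ /(fP i).1].
move=> i; apply: conv_hull_sub (fP i).2 => y /= yf.
by apply/flatten_mapP; exists i; rewrite ?mem_enum.
Qed.

Lemma enorm_coord (u : 'rV[R]_d) k : enorm u <= 1 -> `|u 0 k| <= 1.
Proof.
move=> u1; rewrite -(expr_le1 (n := 2)) // -normrX ger0_norm ?sqr_ge0 //.
have s0 : 0 <= \sum_i u 0 i ^+ 2 by apply: sumr_ge0 => i _; exact: sqr_ge0.
apply: (@le_trans _ _ (\sum_i u 0 i ^+ 2)).
  by rewrite (bigD1 k) //= lerDl sumr_ge0 // => i _; exact: sqr_ge0.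
by rewrite -(sqr_sqrtr s0) expr_le1 // sqrtr_ge0.
Qed.

Lemma enorm_delta k (a : R) : a ^+ 2 = 1 -> enorm (a *: delta_mx 0 k : 'rV[R]_d) <= 1.
Proof.
move=> a1; rewrite /enorm (bigD1 k) //= !mxE !eqxx mulr1 a1 big1 ?addr0 ?sqrtr1 //.
by move=> i /negbTE ik; rewrite !mxE ik andbF mulr0 expr0n.
Qed.

End ConvexHull.

Lemma finite_families (R : realType) (d n : nat) (X : 'I_n -> set 'rV[R]_d)
    (c : 'I_n -> 'rV[R]_d) : (0 < d)%N ->
  (forall i, [set c i + u | u in unit_ball R d] `<=` conv_hull (X i)) ->
  exists m (P : 'I_n -> 'I_m.+1 -> 'rV[R]_d), (forall i k, X i (P i k)) /\
    forall i k, conv_hull (range (P i)) (c i + delta_mx 0 k) /\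
      conv_hull (range (P i)) (c i - delta_mx 0 k).
Proof.
move=> d0 ball_sub.
pose q i (kb : 'I_d * bool) : 'rV[R]_d := c i + (-1) ^+ kb.2 *: delta_mx 0 kb.1.
have pts i kb : conv_hull (X i) (q i kb).
  apply: ball_sub; exists ((-1) ^+ kb.2 *: delta_mx 0 kb.1) => //.
  by apply: enorm_delta; rewrite sqrr_sign.
have sP i : exists s : seq 'rV[R]_d, (forall y, y \in s -> X i y) /\
    forall kb, conv_hull [set y | y \in s] (q i kb).
  by have [s sX sx] := conv_hull_finite_family (pts i); exists s.
have [s {}sP] := choice sP.
have yP i : exists y, X i y.
  exact: (conv_hull_inhabited (pts i (Ordinal d0, true))).
have [y {}yP] := choice yP.
pose m := \max_i size (s i).
(* Lists shorter than the common size are padded with [y i], itself a point of [X i]. *)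
pose P i (k : 'I_m.+1) := nth (y i) (s i) k.
exists m, P; split.
  move=> i k; rewrite /P; have [ks|ks] := ltnP k (size (s i)).
    by apply: (sP i).1; exact: mem_nth.
  by rewrite nth_default.
have sub i : [set z | z \in s i] `<=` range (P i).
  move=> z /= zs; have zm : (index z (s i) < m.+1)%N.
    rewrite ltnS; apply: leq_trans (index_size _ _) _.
    by rewrite /m (bigD1 i) //= leq_maxl.
  by exists (Ordinal zm) => //; rewrite /P /= nth_index.
move=> i k; split; apply: (conv_hull_sub (sub i)).
  by have := (sP i).2 (k, false); rewrite /q expr0 scale1r.
by have := (sP i).2 (k, true); rewrite /q expr1 scaleN1r.
Qed.

(** * The radius and the final perturbation of weights *)

Lemma radius_bound (R : realType) (d : nat) : (2 <= d)%N ->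
  (3 * d)%N%:R ^- (2 * d ^ 2)%N *
    (d%:R * coef_bound d (64 * d%:R ^+ 2)^-1) <= 1 :> R.
Proof.
move=> d2; have d2R : 2 <= d%:R :> R by rewrite (ler_nat R 2).
set x : R := d%:R in d2R *.
have x0 : 0 < x by lra.
have base : 1 <= (3 * d)%N%:R :> R by rewrite (ler_nat R 1); lia.
have pow8 : (3 * d)%N%:R ^+ 8 <= (3 * d)%N%:R ^+ (2 * d ^ 2) :> R.
  (* [8 <= 2 d^2] holds because [d >= 2]; the left-hand polynomial has degree 6 in [d] and lies
     below [(3 d)^8]. *)
  by apply: ler_weXn2l => //; rewrite (leq_mul2l 2 4) (leq_exp2r 2 d (isT : 0 < 2)%N).
have p0 : 0 < (3 * d)%N%:R ^+ (2 * d ^ 2) :> R by rewrite exprn_gt0 //; lra.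
rewrite ler_pdivrMl // mulr1; apply: le_trans pow8.
have -> : x * coef_bound d (64 * x ^+ 2)^-1 =
    101 / 100 * (64 * x ^+ 3 + 4 * (101 / 100 * (2 * 2688 * x ^+ 6))) :> R.
  by rewrite /coef_bound -/x; field; lra.
have -> : (3 * d)%N%:R ^+ 8 = 6561 * x ^+ 8 :> R.
  by rewrite natrM -/x exprMn; ring.
have x2 : 4 <= x ^+ 2 by rewrite expr2; nra.
have x3 : 8 <= x ^+ 3 by rewrite exprS; nra.
have : 8 * x ^+ 3 <= x ^+ 6 by rewrite (exprD x 3 3) ler_wpM2r //; lra.
have : 4 * x ^+ 6 <= x ^+ 8 by rewrite (exprD x 2 6) ler_wpM2r // exprn_ge0 // ltW.
by lra.
Qed.

Theorem theorem1p1 (R : realType) (d : nat) (d_ge2 : (2 <= d)%N)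
  (X : 'I_(2 * d) -> set 'rV[R]_d) (c : 'I_(2 * d) -> 'rV[R]_d)
  (ball_sub : forall i : 'I_(2 * d),
    [set c i + u | u in unit_ball R d] `<=` conv_hull (X i)) :
  exists (x : 'I_(2 * d) -> 'rV[R]_d) (c0 : 'rV[R]_d),
    [/\ forall i : 'I_(2 * d), X i (x i),
        conv_hull (range c) c0 &
        [set c0 + (3 * d)%N%:R ^- (2 * d ^ 2)%N *: u | u in unit_ball R d]
          `<=` conv_hull (range x)].
Proof.
have d_gt0 : (0 < d)%N by exact: ltnW.
have [m [P [PX hull]]] := finite_families d_gt0 ball_sub.
set rho : R := (64 * d%:R ^+ 2)^-1.
have [p [s [[s0 sE sm] span]]] :=
  @spanning_configuration R d (2 * d) m.+1 P c rho d_ge2 erefl hull erefl [ffun=> ord0].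
have [t tP] := choice span.
pose x i := P i (p i).
pose r : R := (3 * d)%N%:R ^- (2 * d ^ 2)%N.
have r0 : 0 <= r by rewrite invr_ge0 exprn_ge0.
have sumL : \sum_i s (inl i) = 1 by rewrite (mass_balance sE).
have centre : \sum_i s (inl i) *: x i = \sum_l s (inr l) *: c l.
  apply/rowP => k; have /rowP/(_ (lshift 1 k)) := sE.
  rewrite /lincomb big_sumType /= !mxE !summxE => /eqP.
  under [X in _ + X == _]eq_bigr do rewrite scalerN mxE.
  rewrite sumrN subr_eq0 => /eqP e1.
  transitivity (\sum_i (s (inl i) *: hat (P i (p i))) 0 (lshift 1 k)).
    by apply: eq_bigr => i _; rewrite [LHS]mxE [RHS]mxE /hat row_mxEl.
  by rewrite e1; apply: eq_bigr => i _; rewrite [RHS]mxE [LHS]mxE /hat row_mxEl.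
exists x, (\sum_l s (inr l) *: c l); split.
- by move=> i; exact: PX.
- by apply: conv_hull_combination => //; rewrite -mass_sum.
move=> _ [u u1 <-]; rewrite -/r -centre.
have u_le k := enorm_coord k u1.
(* Relative perturbation of the colour weights: [radius_bound] keeps the factors nonnegative, and
   the total stays 1 because every [ehat R k] has last coordinate 0. *)
pose w i := s (inl i) * (1 + r * \sum_k u 0 k * t k i).
have uE : u = \sum_i (s (inl i) * \sum_k u 0 k * t k i) *: x i.
  apply/rowP => k'; rewrite summxE.
  under eq_bigr do rewrite mxE mulr_sumr mulr_suml.
  rewrite exchange_big /= (bigD1 k') //=.
  have coord k : \sum_i s (inl i) * (u 0 k * t k i) * x i 0 k' = u 0 k * (k' == k)%:R.
    have /rowP/(_ (lshift 1 k')) := (tP k).2.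
    rewrite summxE /ehat row_mxEl mxE eqxx /= => <-; rewrite mulr_sumr.
    by apply: eq_bigr => i _; rewrite mxE /hat row_mxEl -/(x i); ring.
  rewrite coord eqxx mulr1 big1 ?addr0 // => k kk'.
  by rewrite coord eq_sym (negbTE kk') mulr0.
have -> : \sum_i s (inl i) *: x i + r *: u = \sum_i w i *: x i.
  rewrite {1}uE scaler_sumr -big_split; apply: eq_bigr => i _ /=.
  by rewrite scalerA -scalerDl /w; congr (_ *: _); ring.
apply: conv_hull_combination.
- move=> i; rewrite mulr_ge0 //.
  have : `|\sum_k u 0 k * t k i| <= d%:R * coef_bound d rho.
    apply: le_trans (ler_norm_sum _ _ _) _.
    have -> : d%:R * coef_bound d rho = \sum_(k < d) coef_bound d rho.
      by rewrite sumr_const card_ord mulr_natl.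
    apply: ler_sum => k _; rewrite normrM -[leRHS]mul1r ler_pM //; exact: (tP k).1.
  have := radius_bound R d_ge2; rewrite -/r -/rho => rb tb.
  have : - (r * `|\sum_k u 0 k * t k i|) <= r * \sum_k u 0 k * t k i.
    by rewrite -mulrN ler_wpM2l // lerNl -normrN ler_norm.
  have : r * `|\sum_k u 0 k * t k i| <= r * (d%:R * coef_bound d rho) by rewrite ler_wpM2l.
  by lra.
- have balance k : \sum_i s (inl i) * (u 0 k * t k i) = 0.
    have /rowP/(_ (rshift d 0)) := (tP k).2; rewrite summxE ehat_last => e0.
    transitivity (u 0 k * \sum_i ((t k i * s (inl i)) *: hat (x i)) 0 (rshift d 0)).
      by rewrite mulr_sumr; apply: eq_bigr => i _; rewrite mxE hat_last; ring.
    by rewrite [X in _ * X]e0 mulr0.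
  rewrite /w; under eq_bigr do rewrite mulrDr mulr1.
  rewrite big_split /= sumL.
  under eq_bigr do rewrite mulrCA mulr_sumr.
  by rewrite -mulr_sumr exchange_big /= big1 ?mulr0 ?addr0.
Qed.
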